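(* Let $F$ be any of $R$, $R(X)$ or $R(X,Y)$ with $R$ a real closed field, let $K=F(\sqrt d)$ be an imaginary extension, and let $D=\mathrm{diag}(d_1,\dots,d_n)\in\mathrm{GL}(n,F)$. The following are equivalent. (1) The family $\{d_1,\dots,d_n\}$ is norm closed, i.e. $\prod_{i=1}^n d_i\in N(K)$, and $d_i$ is positive for each $1\le i\le n$. (2) There exists a matrix $Z\in\mathrm{GL}(n,K)$ satisfying $Z^*Z=D$.
   Context: A rational function $f\in R(X_1,\dots,X_m)$ over a real closed field $R$ is called positive if $f(x_1,\dots,x_m)\ge0$ for all $(x_1,\dots,x_m)\in R^m$ at which $f$ is defined (for $m=0$, $f\ge 0$ in $R$). The extension $K=F(\sqrt d)$ with $d\in F^*$ is called imaginary if $d$ is negative, i.e. $-d$ is positive in $F$. The nontrivial element of $\mathrm{Gal}(K/F)$ is $z\mapsto\overline z$, applied entrywise to matrices; $Z^*=\overline Z^T$ and $N(z)=\overline z z$ is the norm $K\to F$. $n$ is a positive integer. *)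

(* Defs.v *)
From HB Require Import structures.
From mathcomp Require Import all_boot all_order all_algebra all_fingroup all_field.
From mathcomp Require Import mpoly.

Set Implicit Arguments.
Unset Strict Implicit.
Unset Printing Implicit Defensive.

Import Order.TTheory GRing.Theory Num.Theory.

Local Open Scope ring_scope.

(* R(X_1, ..., X_m); the case m = 0 is R itself, not fractions over R[]. *)
Definition ratfun (R : rcfType) (m : nat) : fieldType :=
  match m with
  | 0 => R
  | m'.+1 => {fraction {mpoly R[m'.+1]}}
  end.

(* f is defined at x, with value v: some representation of f as a quotient of
   polynomials has a denominator that does not vanish at x. *)
Definition ratfun_value (R : rcfType) (m : nat)
    (f : {fraction {mpoly R[m]}}) (x : 'I_m -> R) (v : R) : Prop :=
  exists p q : {mpoly R[m]},
    [/\ f = FracField.tofrac p / FracField.tofrac q,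
        q.@[x] != 0 &
        v = p.@[x] / q.@[x]].

(* "Positive" means nonnegative: the zero function is positive. *)
Definition positive (R : rcfType) (m : nat) : ratfun R m -> Prop :=
  match m return ratfun R m -> Prop with
  | 0 => fun f : R => 0 <= f
  | m'.+1 => fun f : {fraction {mpoly R[m'.+1]}} =>
      forall (x : 'I_m'.+1 -> R) (v : R), ratfun_value f x v -> 0 <= v
  end.

(* K is generated over F by a square root of delta. *)
Definition is_sqrt_extension (F : fieldType) (K : fieldExtType F) (delta : F)
    : Prop :=
  exists s : K, s ^+ 2 = delta%:A /\ <<1%VS; s>>%VS = fullv.

Definition imaginary_extension (R : rcfType) (m : nat)
    (K : fieldExtType (ratfun R m)) (delta : ratfun R m) : Prop :=
  [/\ delta != 0, positive (- delta) & is_sqrt_extension K delta].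

Section Conjugation.

Variables (F : fieldType) (K : splittingFieldType F) (sigma : gal_of {:K}).

Definition conj_norm (z : K) : K := sigma z * z.

(* c lies in N(K), where N is the norm z |-> sigma z * z, with values in F. *)
Definition is_norm (c : F) : Prop := exists z : K, conj_norm z = c%:A.

Definition norm_closed (n : nat) (a : 'I_n -> F) : Prop :=
  is_norm (\prod_(i < n) a i).

Definition conj_trmx (n : nat) (Z : 'M[K]_n) : 'M[K]_n :=
  (map_mx sigma Z)^T.

End Conjugation.

(* Main.v *)
(* Write <<a, b>> for the quadratic form x^2 + a y^2 + b z^2 + a b w^2.

   (1) => (2).  If a and b are positive, then a N(z) + b N(w) = 1 is solvable in K
   as soon as <<- delta, a b>> represents a.  In that case the hermitian form
   <a, b> is isometric to <1, a b>, and repeating this reduces <d_1, ..., d_n>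
   to <1, ..., 1, d_1 ... d_n>, which is <1, ..., 1> when the product is a norm.
   So everything rests on Pfister's theorem: over R(X, Y), every positive element
   is represented by every form <<p, q>> (R and R(X) follow by specialisation).

   Pfister's theorem combines two facts.
   - A positive element of R(X, Y) is a sum of squares (Artin).  Otherwise R(X, Y)
     has an ordering for which c < 0, and it embeds in a real closed field R''.
     An ultrapower R' of R also contains R(X), with the same ordering, so by the
     invariance of Tarski queries c(X, _), seen as a polynomial over R(X), takes a
     negative value in R' as well, hence c(x, y) < 0 for some x, y in R.
   - Every sum of squares is represented by <<p, q>>.  For sums of two squares
     x^2 + y^2 this is a norm argument starting from a zero of
     <1, p, q, p q, - (x + i y)> over C(X, Y), where C = R(i); such a zero exists
     because r quadratic forms over C in more than r variables have a common zero.
     The general case is an induction on the number of squares. *)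
Require Import Defs.
From HB Require Import structures.
From mathcomp Require Import all_boot all_order all_algebra all_fingroup all_field.
From mathcomp.multinomials Require Import mpoly.
From mathcomp.real_closed Require Import complex polyrcf qe_rcf_th.
From mathcomp.classical Require Import boolp classical_sets filter.
From mathcomp Require Import ring lra zify.

Set Implicit Arguments.
Unset Strict Implicit.
Unset Printing Implicit Defensive.

Import Order.TTheory GRing.Theory Num.Theory.

Local Open Scope ring_scope.

(** * The Nullstellensatz *)

(** [R] may be non-archimedean, so the sum of squares theorem has to produce points of [R] by
    algebra alone. In one variable this is possible: polynomials factor into constants, linear
    factors and sums of two squares, so an ordering of R(X) amounts to a cut in [R]. Points of [R]
    imitate finitely many of its signs, and an ultrafilter collects these imitations into R'.
    Orderings of R(X, Y) have no such description, so Y is left to Tarski queries, which depend only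
    on signs of elements of R(X). R'' is built inside the algebraically closed field R'[i] by one
    use of Zorn's lemma, over preorderings of all its subfields. The form <1, p, q, p q, - (x + i
    y)> has five entries because 5 is the first number above 2^2, the bound for quadratic forms in
    two variables over [C]. From (2) to (1), determinants give the norm condition and the diagonal
    of Z^* Z gives positivity. *)

Record prime_ideal (A : comNzRingType) (m : A -> Prop) : Prop := PrimeIdeal {
  prime_ideal0 : m 0;
  prime_idealD : forall a b, m a -> m b -> m (a + b);
  prime_idealM : forall a b, m b -> m (a * b);
  prime_ideal1 : ~ m 1;
  prime_idealP : forall a b, m (a * b) -> m a \/ m b }.

(** A form of the Nullstellensatz that survives adjoining a variable: in the inductive step [b]
    receives the leading coefficients that must stay nonzero under [phi]. *)
Definition has_points (C A : comNzRingType) (iota : C -> A) : Prop :=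
  forall (m : A -> Prop) (b : A), prime_ideal m -> ~ m b ->
  exists phi : {rmorphism A -> C},
    [/\ forall c, phi (iota c) = c, forall a, m a -> phi a = 0 & phi b != 0].

Lemma min_size_poly (A : nzRingType) (H : {poly A} -> Prop) :
  (exists p, H p) -> exists2 p, H p & forall q, H q -> (size p <= size q)%N.
Proof.
move=> [p Hp].
have : exists n, `[< exists2 q, H q & size q = n >].
  by exists (size p); apply/asboolP; exists p.
case/ex_minnP => n /asboolP [q Hq <-] min.
by exists q => // r Hr; apply: min; apply/asboolP; exists r.
Qed.

Lemma monomials_ideal (A : comNzRingType) (m : {poly A} -> Prop) (p : {poly A}) :
  prime_ideal m -> (forall i, m (p`_i)%:P) -> m p.
Proof.
move=> [m0 mD mM _ _] mp; rewrite -[p]coefK poly_def.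
elim/big_rec: _ => // i q _ mq; apply: mD => //.
by rewrite -mul_polyC mulrC; apply: mM.
Qed.

(** Otherwise subtracting the leading monomial would give a shorter element of [H], still with a
    coefficient outside [m]. *)
Lemma prime_ideal_lead (A : comNzRingType) (m : {poly A} -> Prop)
    (H : {poly A} -> Prop) (p : {poly A}) :
  prime_ideal m -> (forall q r, H q -> m r -> H (q - r)) -> H p ->
  ~ (forall i, m (p`_i)%:P) ->
  (forall q, H q -> ~ (forall i, m (q`_i)%:P) -> (size p <= size q)%N) ->
  ~ m (lead_coef p)%:P.
Proof.
move=> pm HB Hp np min mlp; have [m0 mD mM m1 mP] := pm.
have p0 : p != 0.
  by apply/eqP => p0; apply: np => i; rewrite p0 coef0 polyC0.
have mr : m ((lead_coef p)%:P * 'X^((size p).-1)) by rewrite mulrC; apply: mM.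
set r := _ * _ in mr.
have /min : H (p - r) by apply: HB.
have nq : ~ (forall i, m ((p - r)`_i)%:P).
  move=> mq; apply: np => i; have := mq i; rewrite coefB /r coefCM coefXn.
  case: eqP => [->|_]; last by rewrite mulr0 subr0.
  by move=> _; rewrite -lead_coefE.
move=> /(_ nq); apply/negP; rewrite -ltnNge.
have s0 : (0 < size p)%N by rewrite lt0n size_poly_eq0.
rewrite -[leqRHS](prednK s0) ltnS.
apply/leq_sizeP => j hj; rewrite coefB /r coefCM coefXn.
move: hj; rewrite leq_eqVlt => /orP[/eqP <-|hj].
  by rewrite eqxx mulr1 lead_coefE subrr.
rewrite (gtn_eqF hj) mulr0 subr0 nth_default //.
by rewrite -(prednK s0).
Qed.


(** Let [m'] be the contraction of [m] to [A]. Either [m] is extended from [m'], and a nonroot of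
    the image of [b] completes a point of [m']; or [m] contains some [Q] that is nonzero modulo
    [m']. If its size is minimal, [Q] divides all of [m] modulo [m'], up to powers of its leading
    coefficient, and a root of its image completes the point. *)
Lemma has_points_poly (C : closedFieldType) (A : idomainType)
    (iota : {rmorphism C -> A}) :
  has_points iota -> has_points (fun c => (iota c)%:P).
Proof.
move=> ptA m b pm nmb; have [m0 mD mM m1 mP] := pm.
pose m' a := m a%:P.
have pm' : prime_ideal m'.
  split; rewrite /m' ?polyC0 ?polyC1 //.
  - by move=> a c; rewrite polyCD; apply: mD.
  - by move=> a c; rewrite polyCM; apply: mM.
  - by move=> a c; rewrite polyCM; apply: mP.
have mN a : m a -> m (- a) by rewrite -mulN1r; apply: mM.
have mB a c : m a -> m c -> m (a - c) by move=> ma mc; apply/mD/mN.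
pose zero (p : {poly A}) := forall i, m' p`_i.
have zeroW p : zero p -> m p by apply: monomials_ideal.
have ext (phi : {rmorphism A -> C}) (t : C) :
    (forall c, phi (iota c) = c) -> (forall p, m p -> root (map_poly phi p) t) ->
    ~~ root (map_poly phi b) t ->
    exists psi : {rmorphism {poly A} -> C},
      [/\ forall c, psi (iota c)%:P = c, forall a, m a -> psi a = 0 & psi b != 0].
  move=> phiC phim phib.
  exists (horner_eval t \o map_poly phi); split=> /=.
  - by move=> c; rewrite /horner_eval map_polyC hornerC; apply: phiC.
  - by move=> a /phim/rootP.
  - by [].
have [|] := pselect (forall p, m p -> zero p) => [allz|].
  have nzb : ~ zero b by move/zeroW.
  have /existsNP [j nmj] := nzb.
  have [phi [phiC phim phib]] := ptA _ _ pm' nmj.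
  have /closed_nonrootP [t nt] : map_poly phi b != 0.
    by apply: contraNneq phib => e; rewrite -coef_map e coef0.
  apply: (ext phi t) => // p /allz zp.
  suff -> : map_poly phi p = 0 by rewrite root0.
  by apply/polyP => i; rewrite coef_map coef0; apply: phim.
move=> /existsNP [P0 /not_implyP [mP0 nzP0]].
have [Q [mQ nzQ] minQ] :
    exists2 Q, (m Q /\ ~ zero Q) & forall q, m q /\ ~ zero q -> (size Q <= size q)%N.
  by apply: min_size_poly; exists P0.
have lQ : ~ m' (lead_coef Q).
  by apply: (prime_ideal_lead pm _ mQ nzQ) => // q mq nq; apply: minQ.
have Q0 : Q != 0 by apply/eqP => Q0; apply: nzQ => i; rewrite Q0 coef0; case: pm'.
have zmod p : m p -> (size p < size Q)%N -> zero p.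
  move=> mp sp; apply: contrapT => nzp; have := minQ p (conj mp nzp).
  by rewrite leqNgt sp.
(* Some element U b + V with V in m is a nonzero constant modulo m. *)
pose H (h : {poly A}) := exists u, m (h - u * b).
have HB q r : H q -> m r -> H (q - r).
  by move=> [u mu] mr; exists u; rewrite addrAC; apply: mB.
have [h [Hh nzh] minh] :
    exists2 h, (H h /\ ~ zero h) & forall q, H q /\ ~ zero q -> (size h <= size q)%N.
  by apply: min_size_poly; exists Q; split => //; exists 0; rewrite mul0r subr0.
have lh : ~ m' (lead_coef h).
  by apply: (prime_ideal_lead pm HB Hh nzh) => // q mq nq; apply: minh.
have h0 : h != 0 by apply/eqP => h0; apply: nzh => i; rewrite h0 coef0; case: pm'.
have m'X a k : ~ m' a -> ~ m' (a ^+ k).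
  case: pm' => _ _ _ m'1 m'P na; elim: k => [|k IHk] //.
  by rewrite exprS => /m'P [].
have Hmod p : H p -> (size p < size h)%N -> zero p.
  move=> Hp sp; apply: contrapT => nzp; have := minh p (conj Hp nzp).
  by rewrite leqNgt sp.
have sh : (size h <= 1)%N.
  rewrite leqNgt; apply/negP => sh1.
  have hQ : m h -> False.
    move=> mh; have := minQ h (conj mh nzh) => sQh.
    have := Pdiv.Idomain.divp_eq b Q; set k := scalp _ _ => e.
    have Hr : H (b %% Q).
      exists ((lead_coef Q ^+ k)%:P); rewrite mul_polyC e opprD addrC addrNK.
      exact/mN/mM.
    have /zeroW mr : zero (b %% Q).
      apply: Hmod => //; apply: leq_trans sQh; by rewrite Pdiv.Idomain.ltn_modp.
    have : m (lead_coef Q ^+ k *: b) by rewrite e; apply: mD mr; apply: mM.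
    by rewrite -mul_polyC => /mP [/m'X|].
  (* Pseudo-division of [Q] by [h] puts [S * h] in [m]. Neither factor can be there: [h] by [hQ],
     and [S] because it is shorter than [Q]. *)
  have := Pdiv.Idomain.divp_eq Q h; set k := scalp _ _; set S := _ %/ _ => e.
  have Hr : H (Q %% h).
    have [u mu] := Hh; exists (- S * u).
    have -> : Q %% h - - S * u * b = lead_coef h ^+ k *: Q - S * (h - u * b).
      by rewrite e; ring.
    by apply: mB; rewrite -?mul_polyC; apply: mM.
  have /zeroW mr : zero (Q %% h) by apply: Hmod => //; by rewrite Pdiv.Idomain.ltn_modp.
  have : m (S * h).
    have -> : S * h = lead_coef h ^+ k *: Q - Q %% h by rewrite e; ring.
    by apply: mB => //; rewrite -mul_polyC; apply: mM.
  case/mP => // mS.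

  have lhk : lead_coef h ^+ k != 0 by rewrite expf_neq0 ?lead_coef_eq0.
  have sQh : (size h <= size Q)%N.
    by apply: minh; split => //; exists 0; rewrite mul0r subr0.
  have sr : (size (- (Q %% h)) < size (lead_coef h ^+ k *: Q))%N.
    rewrite size_polyN size_scale //; apply: leq_trans sQh.
    by rewrite Pdiv.Idomain.ltn_modp.
  have eS : S * h = lead_coef h ^+ k *: Q - Q %% h by rewrite e; ring.
  have nzS : ~ zero S.
    move=> /(_ (size S).-1); rewrite -lead_coefE => lS.
    have : m' (lead_coef (S * h)).
      rewrite lead_coefM mulrC; exact: (prime_idealM pm').
    rewrite eS lead_coefDl // lead_coefZ => /(prime_idealP pm') [|//].
    exact: m'X.
  have S0 : S != 0 by apply/eqP => S0; apply: nzS => i; rewrite S0 coef0; case: pm'.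
  have := minQ S (conj mS nzS).
  have : size (S * h) = size Q by rewrite eS size_polyDl // size_scale.
  rewrite size_mul // => <-; move: sh1; case: (size h) => [|[|s]] //.
  by rewrite !addnS /= => _; rewrite ltnNge leq_addr.
have [c hc] : exists c, h = c%:P by exists h`_0; apply: size1_polyC.
have nmc : ~ m' c by rewrite hc lead_coefC in lh.
(* The point has to preserve the degree of [Q], so that a root exists, and the constant [c], which
   keeps [b] nonzero at that root. *)
have nmab : ~ m' (lead_coef Q * c) by case/(prime_idealP pm').
have [phi [phiC phim]] := ptA _ _ pm' nmab.
rewrite rmorphM mulf_eq0 negb_or => /andP[phiQ phic].
have sQ1 : (1 < size Q)%N.
  rewrite ltnNge; apply/negP => sQ; apply: lQ.
  by rewrite /m' lead_coefE; move: (sQ) mQ; rewrite [in m Q](size1_polyC sQ);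
     case: (size Q) sQ => [|[|]].
have sphi : size (map_poly phi Q) = size Q by rewrite size_map_poly_id0.
have /closed_rootP [t rt] : size (map_poly phi Q) != 1.
  by rewrite sphi; case: (size Q) sQ1 => [|[|]].
have rm p : m p -> root (map_poly phi p) t.
  move=> mp; have := Pdiv.Idomain.divp_eq p Q; set k := scalp _ _ => e.
  have zr : zero (p %% Q).
    apply: zmod; last by rewrite Pdiv.Idomain.ltn_modp.
    have -> : p %% Q = lead_coef Q ^+ k *: p - p %/ Q * Q by rewrite e; ring.
    by apply: mB; rewrite -?mul_polyC; apply: mM.
  have : root (map_poly phi (lead_coef Q ^+ k *: p)) t.
    rewrite e rmorphD rmorphM /= /root hornerD hornerM (rootP rt) mulr0 add0r.
    suff -> : map_poly phi (p %% Q) = 0 by rewrite horner0.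
    by apply/polyP => i; rewrite coef_map coef0; apply: phim.
  by rewrite map_polyZ rootZ // rmorphXn expf_neq0.
apply: (ext phi t) => //.
have [u mu] := Hh; apply: contra phic => rb.
have := rm _ mu; rewrite rmorphB rmorphM /= /root hornerD hornerN hornerM (rootP rb).
by rewrite mulr0 subr0 hc map_polyC hornerC.
Qed.

Record is_ideal (A : comNzRingType) (I : A -> Prop) : Prop := IsIdeal {
  ideal0 : I 0;
  idealD : forall a b, I a -> I b -> I (a + b);
  idealM : forall a b, I b -> I (a * b) }.

Section PrimeAvoidance.
Local Open Scope classical_set_scope.

Lemma prime_avoiding_powers (A : comNzRingType) (I : A -> Prop) (b : A) :
  is_ideal I -> (forall k, ~ I (b ^+ k)) ->
  exists m, [/\ prime_ideal m, forall a, I a -> m a & ~ m b].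
Proof.
move=> idI nIb.
(* Adding [I] makes the union of the empty chain satisfy the property. *)
pose P (J : set A) := is_ideal (J `|` I) /\ forall k, ~ (J `|` I) (b ^+ k).
have [|J [[idJ nJb] maxJ]] := @Zorn_bigcup A P.
  move=> F FP tot; split; last first.
    move=> k [[J FJ Jb]|]; last exact: nIb.
    by have [_ /(_ k)] := FP _ FJ; apply; left.
  have two a c : (\bigcup_(X in F) X `|` I) a -> (\bigcup_(X in F) X `|` I) c ->
      (I a /\ I c) \/ exists2 J, F J & (J `|` I) a /\ (J `|` I) c.
    move=> [[J FJ Ja]|Ia] [[J' FJ' Jc]|Ic].
    - right; have [JJ'|J'J] := tot _ _ FJ FJ'.
        by exists J' => //; split; left => //; apply: JJ'.
      by exists J => //; split; left => //; apply: J'J.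
    - by right; exists J => //; split; [left|right].
    - by right; exists J' => //; split; [right|left].
    - by left.
  have up J a : F J -> (J `|` I) a -> (\bigcup_(X in F) X `|` I) a.
    by move=> FJ [Ja|Ia]; [left; exists J|right].
  have [I0 ID IM] := idI; split.
  - by right.
  - move=> a c ha hc; case: (two _ _ ha hc) => [[Ia Ic]|[J FJ [Ja Jc]]].
      by right; apply: ID.
    by apply: (up J) => //; have [[_ D _] _] := FP _ FJ; apply: D.
  - move=> a c hc; case: (two _ _ hc hc) => [[_ Ic]|[J FJ [_ Jc]]].
      by right; apply: IM.
    by apply: (up J) => //; have [[_ _ M] _] := FP _ FJ; apply: M.
exists (J `|` I); have [J0 JD JM] := idJ; split; last 2 first.
- by right.
- by have := nJb 1%N; rewrite expr1.
(* By maximality, adjoining [x] produces a power of [b]; the product of two such relations handles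
   [x * y]. *)
have grow x : ~ (J `|` I) x -> exists k, exists u, (J `|` I) (b ^+ k - u * x).
  move=> nx; pose J' := [set y | exists u, (J `|` I) (y - u * x)].
  have JJ' y : (J `|` I) y -> J' y by exists 0; rewrite mul0r subr0.
  have IJ' y : (J' `|` I) y -> J' y by case=> // Iy; apply: JJ'; right.
  have /maxJ : J `<` J'.
    split; first by move=> y Jy; apply: JJ'; left.
    move=> J'J; apply: nx; left; apply: J'J.
    by exists 1; rewrite mul1r subrr.
  move=> /not_andP [|/existsNP [k]]; last first.
    by move=> /contrapT /IJ' [u hu]; exists k, u.
  case; split.
  - by left; apply: JJ'.
  - move=> y z /IJ' [u hu] /IJ' [v hv]; left; exists (u + v).
    have -> : y + z - (u + v) * x = (y - u * x) + (z - v * x) by ring.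
    exact: JD.
  - move=> y z /IJ' [v hv]; left; exists (y * v).
    have -> : y * z - y * v * x = y * (z - v * x) by ring.
    exact: JM.
split => //; first by have := nJb 0%N; rewrite expr0.
move=> x y Jxy; apply: contrapT => /not_orP [/grow [k [u hu]] /grow [l [v hv]]].
apply: (nJb (k + l)%N); rewrite exprD.
have -> : b ^+ k * b ^+ l = b ^+ l * (b ^+ k - u * x) +
   ((u * x) * (b ^+ l - v * y) + (u * v) * (x * y)) by ring.
by apply: (JD); [apply: JM|apply: (JD); apply: JM].
Qed.

End PrimeAvoidance.

Lemma mpoly_rmorphism_ext (R : comNzRingType) (n : nat) (S : comNzRingType)
    (f g : {rmorphism {mpoly R[n]} -> S}) :
  (forall c, f c%:MP = g c%:MP) -> (forall i, f 'X_i = g 'X_i) -> f =1 g.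
Proof.
move=> fgC fgX p; rewrite [p]mpolyE !rmorph_sum /=; apply: eq_bigr => m _.
rewrite -mul_mpolyC !rmorphM /= fgC; congr (_ * _).
rewrite mpolyXE_id !rmorph_prod /=; apply: eq_bigr => i _.
by rewrite !rmorphXn /= fgX.
Qed.

Section LastVariable.
Variables (A : comNzRingType) (n : nat).

Definition last_var (i : 'I_n.+1) : {poly {mpoly A[n]}} :=
  if unlift ord_max i is Some j then ('X_j)%:P else 'X.

Definition mpoly_split : {rmorphism {mpoly A[n.+1]} -> {poly {mpoly A[n]}}} :=
  mmap (polyC \o @mpolyC n A) last_var.

Lemma mpoly_splitC c : mpoly_split c%:MP = (c%:MP)%:P.
Proof. by rewrite /mpoly_split /= mmapC. Qed.

Lemma mwiden_commr : commr_rmorph (@mwiden n A) ('X_ord_max : {mpoly A[n.+1]}).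
Proof. by move=> x; apply: mulrC. Qed.

Definition mpoly_unsplit : {rmorphism {poly {mpoly A[n]}} -> {mpoly A[n.+1]}} :=
  horner_morph mwiden_commr.

Lemma mpoly_splitK : cancel mpoly_split mpoly_unsplit.
Proof.
apply: (mpoly_rmorphism_ext (f := mpoly_unsplit \o mpoly_split) (g := idfun)) => [c|i].
  rewrite [LHS]/= mmapC; apply: etrans (horner_morphC mwiden_commr _) _.
  exact: mwidenC.
rewrite [LHS]/= mmapX mmap1U /last_var; case: unliftP => [j ->|->] /=; last first.
  exact: horner_morphX.
apply: etrans (horner_morphC mwiden_commr _) _; apply: etrans (mwidenX _ _) _.
by rewrite mnmwiden1; congr 'X__; apply/val_inj; rewrite /= /bump leqNgt ltn_ord.
Qed.

End LastVariable.

Arguments mpoly_split {A n}.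
Arguments mpoly_unsplit {A n}.

Lemma has_points_mpoly (C : closedFieldType) (n : nat) :
  has_points (fun c : C => c%:MP_[n]).
Proof.
elim: n => [|n IHn].
  move=> m b [m0 mD mM m1 mP] nmb.
  have mC (p : {mpoly C[0]}) : p = (p@_0)%:MP.
    apply/mpolyP => k; rewrite mcoeffC.
    have -> : k = 0%MM by apply/mnmP; case.
    by rewrite eqxx mulr1.
  have mz p : m p -> p@_0 = 0.
    move=> mp; apply: contrapT => /eqP p0; apply: m1.
    have -> : 1 = ((p@_0)^-1)%:MP * p by rewrite {2}[p]mC -mpolyCM mulVf.
    exact: mM.
  exists (mcoeff 0%MM); split => //=.
    by move=> c; rewrite mcoeffC eqxx mulr1.
  by apply/eqP => b0; apply: nmb; rewrite [b]mC b0 mpolyC0.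
have := has_points_poly (iota := @mpolyC n C : {rmorphism C -> {mpoly C[n]}}) IHn.
move=> ptP m b pm nmb.
pose m' p := m (mpoly_unsplit p).
have pm' : prime_ideal m'.
  have [m0 mD mM m1 mP] := pm; split; rewrite /m' ?rmorph0 ?rmorph1 //.
  - by move=> p q; rewrite rmorphD; apply: mD.
  - by move=> p q; rewrite rmorphM; apply: mM.
  - by move=> p q; rewrite rmorphM; apply: mP.
have nmb' : ~ m' (mpoly_split b) by rewrite /m' mpoly_splitK.
have [phi [phiC phim phib]] := ptP _ _ pm' nmb'.
exists (phi \o @mpoly_split C n); split => //.
  by move=> c; apply: etrans (phiC c); congr (phi _); apply: mpoly_splitC.
by move=> a ma; apply: phim; rewrite /m' mpoly_splitK.
Qed.

Theorem nullstellensatz (C : closedFieldType) (n : nat) (I : {mpoly C[n]} -> Prop)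
    (b : {mpoly C[n]}) :
  is_ideal I -> (forall k, ~ I (b ^+ k)) ->
  exists2 v : 'I_n -> C, forall p, I p -> p.@[v] = 0 & b.@[v] != 0.
Proof.
move=> idI nIb; have [m [pm Im nmb]] := prime_avoiding_powers idI nIb.
have [phi [phiC phim phib]] := has_points_mpoly pm nmb.
pose v i := phi 'X_i; have phiE : phi =1 meval v.
  by apply: mpoly_rmorphism_ext => [c|i] /=; rewrite ?mevalC ?mevalXU ?phiC.
by exists v => [p /Im|]; rewrite -phiE //; apply: phim.
Qed.

(** * Common zeros of homogeneous polynomials *)

Section Span.
Variables (C : fieldType) (n r M : nat) (f : 'I_r -> {mpoly C[n]}).

(** A degree-bounded way to say that monomials with exponents below [M] generate C[X] as a module
    over C[f_1, ..., f_r]. The bound [D] on the exponents of the f_j allows dimensions to be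
    counted. *)
Inductive reduced_span (D : nat) : {mpoly C[n]} -> Prop :=
| reduced_span0 : reduced_span D 0
| reduced_spanD c (m : 'X_{1..n}) (e : 'X_{1..r}) q :
    (forall i, m i < M)%N -> (forall j, e j <= D)%N -> reduced_span D q ->
    reduced_span D (c *: ('X_[m] * mmap1 f e) + q).

Lemma reduced_span_add D p q :
  reduced_span D p -> reduced_span D q -> reduced_span D (p + q).
Proof.
move=> sp sq; elim: sp => [|c m e p' mM eD _ IH]; first by rewrite add0r.
by rewrite -addrA; apply: reduced_spanD.
Qed.

Lemma reduced_span_scale D c p : reduced_span D p -> reduced_span D (c *: p).
Proof.
elim=> [|c' m e p' mM eD _ IH]; first by rewrite scaler0; apply: reduced_span0.
by rewrite scalerDr scalerA; apply: reduced_spanD.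
Qed.

Lemma reduced_span_sum D (I : Type) (s : seq I) (P : pred I) F :
  (forall i, P i -> reduced_span D (F i)) -> reduced_span D (\sum_(i <- s | P i) F i).
Proof.
move=> sF; elim/big_ind: _ => //; first exact: reduced_span0.
exact: reduced_span_add.
Qed.

Lemma reduced_span_mul D p j : reduced_span D p -> reduced_span D.+1 (p * f j).
Proof.
elim=> [|c m e q mM eD _ IH]; first by rewrite mul0r; apply: reduced_span0.
rewrite mulrDl -scalerAl -mulrA.
have -> : mmap1 f e * f j = mmap1 f (e + U_(j)).
  by rewrite commr_mmap1_M ?mmap1U // => i x; apply: mulrC.
apply: reduced_spanD => // k; rewrite mnmDE mnm1E -addn1.
by apply: leq_add => //; case: (_ == _).
Qed.

Lemma reduced_spanP D p : reduced_span D p ->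
  exists l : {ffun 'I_n -> 'I_M} * {ffun 'I_r -> 'I_D.+1} -> C,
  p = \sum_j l j *: ('X_[[multinom (j.1 i : nat) | i < n]]
                     * mmap1 f [multinom (j.2 i : nat) | i < r]).
Proof.
elim=> [|c m e q mM eD _ [l ->]].
  by exists (fun=> 0); rewrite big1 // => j _; rewrite scale0r.
pose j0 := ([ffun i => Ordinal (mM i)], [ffun i => Ordinal (eD i : (e i < D.+1)%N)]).
exists (fun j => (if j == j0 then c else 0) + l j).
under [RHS]eq_bigr do rewrite scalerDl.
rewrite big_split /=; congr (_ + _).
rewrite (bigD1 j0) //= eqxx big1 => [|j /negPf ->]; last by rewrite scale0r.
rewrite addr0; congr (_ *: (_ * _)).
  by congr 'X_[_]; apply/mnmP => i; rewrite mnmE ffunE.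
by congr mmap1; apply/mnmP => i; rewrite mnmE ffunE.
Qed.

Hypothesis power_in_ideal : forall i, exists g : 'I_r -> {mpoly C[n]},
  'X_i ^+ M = \sum_j g j * f j /\ forall j m, m \in msupp (g j) -> (mdeg m < M)%N.

(** A power X_i^M inside a monomial is replaced with the sum of the g_j f_j. As g_j has degree less
    than [M], the cofactor of f_j has smaller degree, which pays for the additional factor f_j. *)
Lemma reduced_span_total D p :
  (forall m, m \in msupp p -> mdeg m <= D)%N -> reduced_span D p.
Proof.
elim/ltn_ind: D p => D IH p pD; rewrite [p]mpolyE big_seq.
apply: reduced_span_sum => d /pD {pD} dD; apply: reduced_span_scale.
have [dM|/existsNP [i /negP]] := pselect (forall i, d i < M)%N.
  have -> : 'X_[d] = 1 *: ('X_[d] * mmap1 f 0%MM) + 0.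
    by rewrite mmap11 mulr1 addr0 scale1r.
  apply: reduced_spanD => //; last exact: reduced_span0.
  by move=> j; rewrite mnm0E.
rewrite -leqNgt => Mdi.
have [g [gE gM]] := power_in_ideal i.
have le : (U_(i) *+ M <= d)%MM.
  apply/mnm_lepP => k; rewrite mulmnE mnm1E; case: eqP => [<-|_] //.
  by rewrite mul1n.
rewrite -(submK le) mpolyXD -mpolyXn gE mulr_sumr.
set d' := (d - _)%MM.
have d'D : (mdeg d' + M <= D)%N.
  apply: leq_trans dD; rewrite -[in leqRHS](submK le) mdegD -/d'.
  by rewrite mdegMn mdeg1 mul1n.
apply: reduced_span_sum => j _; rewrite mulrA.
have [M0|M0] := posnP M.
  have -> : g j = 0.
    apply/mpolyP => m; rewrite mcoeff0; apply: memN_msupp_eq0.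
    by apply/negP => /gM; rewrite M0.
  by rewrite mulr0 mul0r; apply: reduced_span0.
have D0 : (0 < D)%N by apply: leq_trans d'D; rewrite addn_gt0 M0 orbT.
rewrite -(prednK D0); apply/reduced_span_mul/IH; first by rewrite prednK.
move=> m; rewrite mulrC (perm_mem (msuppMX _ _)) => /mapP [k /gM kM ->].
rewrite mdegD -ltnS prednK //; apply: leq_trans d'D.
by rewrite ltn_add2l.
Qed.

(** The [T ^ n] monomials with exponents below [T] are independent and have degree at most [n * T],
    so they lie in the span of [M ^ n * (n * T).+1 ^ r] products. The identity matrix factors
    through that many coordinates. *)
Lemma reduced_span_count T :
  (T ^ n <= M ^ n * (n * T).+1 ^ r)%N.
Proof.
pose mon (a : {ffun 'I_n -> 'I_T}) := [multinom (a i : nat) | i < n].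
pose J := ({ffun 'I_n -> 'I_M} * {ffun 'I_r -> 'I_(n * T).+1})%type.
pose G (j : J) : {mpoly C[n]} := 'X_[[multinom (j.1 i : nat) | i < n]]
                     * mmap1 f [multinom (j.2 i : nat) | i < r].
have spanX a : exists l : J -> C, 'X_[mon a] = \sum_j l j *: G j.
  apply/reduced_spanP/reduced_span_total => m; rewrite msuppX inE => /eqP ->.
  rewrite mdegE; apply: (@leq_trans (\sum_(i < n) T)%N).
    by apply: leq_sum => i _; rewrite mnmE ltnW.
  by rewrite sum_nat_const card_ord.
have [l lE] := choice spanX.
pose L := \matrix_(u < #|{ffun 'I_n -> 'I_T}|, v < #|{: J}|) l (enum_val u) (enum_val v).
pose K := \matrix_(v < #|{: J}|, u < #|{ffun 'I_n -> 'I_T}|) (G (enum_val v))@_(mon (enum_val u)).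
have : L *m K = 1%:M.
  apply/matrixP => u v; rewrite !mxE.
  have mon_inj : injective mon.
    move=> a b /mnmP ab; apply/ffunP => i; apply/val_inj.
    by have := ab i; rewrite !mnmE.
  transitivity (('X_[C, mon (enum_val u)])@_(mon (enum_val v))).
    rewrite lE raddf_sum /= (reindex (@enum_val J {: J})) /=; last first.
      by apply: onW_bij; apply: enum_val_bij.
    by apply: eq_bigr => w _; rewrite !mxE mcoeffZ.
  by rewrite mcoeffX (inj_eq mon_inj) (inj_eq enum_val_inj).
move=> /mulmx1_min; rewrite card_prod !card_ffun !card_ord.
by [].
Qed.

End Span.

Lemma pow_count_contra (n r M : nat) : (r < n)%N ->
  exists T, ~~ (T ^ n <= M ^ n * (n * T).+1 ^ r)%N.
Proof.
(* As (n T + 1)^r <= (n + 1)^r T^r, it suffices that T^(n - r) exceeds M^n (n + 1)^r. Already [T]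
   does, and n - r >= 1. *)
move=> rn; exists (M ^ n * n.+1 ^ r).+1; rewrite -ltnNge; set T := (M ^ n * n.+1 ^ r).+1.
have T1 : (0 < T)%N by [].
have le : ((n * T).+1 <= n.+1 * T)%N by rewrite [leqRHS]mulSn -add1n leq_add2r.
apply: (@leq_ltn_trans (M ^ n * (n.+1 ^ r * T ^ r))%N).
  have pow_le a b k : (a <= b -> a ^ k <= b ^ k)%N.
    by move=> ab; elim: k => // k IHk; rewrite !expnS leq_mul.
  by rewrite leq_mul2l -expnMn pow_le ?orbT.
rewrite mulnA -[in ltnRHS](subnK rn) expnD expnS.
apply: (@leq_trans (T * T ^ r)%N); first by rewrite ltn_mul2r expn_gt0 T1 /= /T.
by apply: leq_pmull; rewrite expn_gt0 T1.
Qed.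

Lemma pihomog_mul_homog (C : comNzRingType) n (g f : {mpoly C[n]}) M dg :
  (0 < dg)%N -> f \is dg.-homog ->
  exists2 h, pihomog mdeg M (g * f) = h * f & forall m, m \in msupp h -> (mdeg m < M)%N.
Proof.
move=> dg0 hf.
(* The part of [g] of degree [M - dg], which is less than [M] because [dg] is positive. *)
exists (\sum_(m <- msupp g | (mdeg m + dg == M)%N) g@_m *: 'X_[m]).
  rewrite {1}[g]mpolyE !mulr_suml raddf_sum [RHS]big_mkcond /=; apply: eq_bigr => m _.
  have hm : ('X_[m] * f) \is (mdeg m + dg)%N.-homog by apply: dhomogM; rewrite ?dhomogX.
  rewrite -scalerAl linearZ /=; case: eqP => [<-|/eqP ne].
    by rewrite pihomog_dE.
  by rewrite (pihomog_ne0 ne hm) scaler0.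
move=> m /msupp_sum_le /flattenP [s /mapP [k]].
rewrite mem_filter => /andP[/eqP <- _] -> /msuppZ_le; rewrite msuppX inE => /eqP ->.
by rewrite -addn1 leq_add2l.
Qed.

(* If 0 were the only common zero, then by the Nullstellensatz the ideal would
   contain a power of each variable, so that C[X] would be finite over
   C[f_1, ..., f_r], against the count of monomials. *)
Theorem common_zero_homog (C : closedFieldType) (n r dg : nat)
    (f : 'I_r -> {mpoly C[n]}) :
  (r < n)%N -> (0 < dg)%N -> (forall j, f j \is dg.-homog) ->
  exists v : 'I_n -> C, (forall j, (f j).@[v] = 0) /\ exists i, v i != 0.
Proof.
move=> rn dg0 hf; apply: contrapT => nz.
pose I (p : {mpoly C[n]}) := exists g : 'I_r -> {mpoly C[n]}, p = \sum_j g j * f j.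
have idI : is_ideal I.
  split.
  - by exists (fun=> 0); rewrite big1 // => j _; rewrite mul0r.
  - move=> _ _ [g ->] [h ->]; exists (fun j => g j + h j).
    by rewrite -big_split; apply: eq_bigr => j _; rewrite mulrDl.
  - move=> a _ [g ->]; exists (fun j => a * g j).
    by rewrite mulr_sumr; apply: eq_bigr => j _; rewrite mulrA.
have powI i : exists k, I ('X_i ^+ k).
  apply: contrapT => /forallNP nI; apply: nz.
  have [v Iv] := nullstellensatz idI nI; rewrite mevalXU => vi.
  exists v; split; last by exists i.
  move=> j; apply: Iv; exists (fun j' => (j' == j)%:R).
  by rewrite (bigD1 j) //= eqxx mul1r big1 ?addr0 // => j' /negPf ->; rewrite mul0r.
have [k kI] := choice powI; pose M := (\sum_i k i)%N.
have powM i : exists g : 'I_r -> {mpoly C[n]}, 'X_i ^+ M = \sum_j g j * f j /\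
    forall j m, m \in msupp (g j) -> (mdeg m < M)%N.
  have [g gE] : I ('X_i ^+ M).
    by rewrite /M (bigD1 i) //= addnC exprD; apply: (idealM idI).
  have /choice [h hE] : forall j, exists h, pihomog mdeg M (g j * f j) = h * f j /\
      forall m, m \in msupp h -> (mdeg m < M)%N.
    by move=> j; have [h] := pihomog_mul_homog (g j) M dg0 (hf j); exists h.
  exists h; split; last by move=> j; case: (hE j).
  have : pihomog mdeg M ('X_i ^+ M : {mpoly C[n]}) = 'X_i ^+ M.
    by apply: pihomog_dE; rewrite mpolyXn dhomogX /= mdegMn mdeg1 mul1n.
  rewrite gE raddf_sum => <-; apply: eq_bigr => j _; by case: (hE j).
have [T] := pow_count_contra M rn.
by rewrite (reduced_span_count powM).
Qed.

(** * Quadratic forms over C(X, Y) *)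

Section QuadraticForms.
Variables (C : closedFieldType) (d : nat) (c : 'I_d -> {poly {poly C}}).

Let mon (u : nat * nat) : {poly {poly C}} := ('X^(u.2))%:P * 'X^(u.1).

Let coef2_mon (p : {poly {poly C}}) u w l l' :
  (p * (mon u * mon w))`_l`_l' =
  if (l < u.1 + w.1)%N || (l' < u.2 + w.2)%N then 0
  else p`_(l - (u.1 + w.1))`_(l' - (u.2 + w.2)).
Proof.
have -> : p * (mon u * mon w) = (p * 'X^(u.1 + w.1)) * ('X^(u.2 + w.2))%:P.
  by rewrite /mon !exprD polyCM; ring.
rewrite coefMC coefMXn; case: ltnP => _ /=; first by rewrite mul0r coef0.
by rewrite coefMXn.
Qed.

(* Undetermined coefficients: bounding all degrees of z by N leaves about
   (2N)^2 equations in d N^2 > 4 N^2 unknowns. *)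
Theorem quadratic_form_isotropic_bivariate : (4 < d)%N ->
  exists z : 'I_d -> {poly {poly C}},
    \sum_k c k * z k ^+ 2 = 0 /\ exists k, z k != 0.
Proof.
move=> d4.
pose s := (\max_k maxn (size (c k)) (\max_(i < size (c k)) size ((c k)`_i)%R))%N.
have cs k l l' : (s <= l)%N || (s <= l')%N -> (c k)`_l`_l' = 0.
  have [lk|lk] := leqP (size (c k)) l; first by rewrite (nth_default 0 lk) coef0.
  have ks : (size (c k) <= s)%N.
    by apply: leq_trans (leq_bigmax k); rewrite leq_maxl.
  have kls : (size ((c k)`_l)%R <= s)%N.
    apply: leq_trans (leq_bigmax k); rewrite leq_max; apply/orP; right.
    exact: (leq_bigmax (F := fun i : 'I_(size (c k)) => size ((c k)`_i)%R) (Ordinal lk)).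
  case/orP => sl; last by rewrite [LHS]nth_default // (leq_trans kls).
  by move: (leq_trans ks sl); rewrite leqNgt lk.
(* The sum has size at most [E] in each variable. This [N] gives E^2 = 121 s^2 + 44 s + 4 < 125 s^2
   + 50 s + 5 = 5 N^2. *)
pose N := (5 * s).+1; pose E := (2 * N + s)%N.
pose V := ('I_d * ('I_N * 'I_N))%type; pose U := ('I_E * 'I_E)%type.
pose nat2 (u : 'I_N * 'I_N) : nat * nat := (val u.1, val u.2).
pose a k (u w : 'I_N * 'I_N) (l : U) : C :=
  (c k * (mon (nat2 u) * mon (nat2 w)))`_(l.1)`_(l.2).
pose f (l : 'I_#|{: U}|) : {mpoly C[#|{: V}|]} :=
  \sum_(k < d) \sum_u \sum_w
     a k u w (enum_val l) *: ('X_(enum_rank (k, u)) * 'X_(enum_rank (k, w))).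
have count : (#|{: U}| < #|{: V}|)%N.
  rewrite !card_prod !card_ord; apply: (@leq_trans (5 * (N * N))%N).
    by rewrite /E /N; nia.
  by rewrite leq_mul2r d4 orbT.
have hf l : f l \is 2.-homog.
  rewrite /f; do 3 (apply: rpred_sum => ? _).
  by apply: rpredZ; rewrite -mpolyXD dhomogX /= mdegD !mdeg1.
have [v [fv0 [x vx]]] := common_zero_homog count (isT : (0 < 2)%N) hf.
pose z k : {poly {poly C}} := \sum_u (v (enum_rank (k, u)))%:P%:P * mon (nat2 u).
exists z; split; last first.
  case ex : (enum_val x) => [k [i j]]; exists k; apply: contraNneq vx => zk0.
  have : (z k)`_i`_j = 0 by rewrite zk0 !coef0.
  have coef_mon u : (mon (nat2 u))`_i`_j = (u == (i, j))%:R.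
    rewrite /mon /= coefCM coefXn /=; case: u => u1 u2 /=; rewrite xpair_eqE.
    have [/val_inj->|ne] := eqVneq (i : nat) u1; last first.
      rewrite mulr0 coef0; case: eqP => // e; by rewrite e eqxx in ne.
    rewrite eqxx mulr1 coefXn [in RHS]eq_sym; by rewrite -val_eqE.
  rewrite /z coef_sum coef_sum (bigD1 (i, j)) //= big1 => [|u /negPf ne].
    by rewrite coefCM coefCM coef_mon eqxx mulr1 addr0 -ex enum_valK => ->.
  by rewrite coefCM coefCM coef_mon ne mulr0.
apply/polyP => l; apply/polyP => l'; rewrite !coef0.
have zE k : c k * z k ^+ 2 = \sum_u \sum_w
    (v (enum_rank (k, u)) * v (enum_rank (k, w)))%:P%:P *
    (c k * (mon (nat2 u) * mon (nat2 w))).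
  rewrite expr2 /z mulr_suml mulr_sumr; apply: eq_bigr => u _.
  rewrite !mulr_sumr; apply: eq_bigr => w _; rewrite !polyCM; ring.
rewrite (eq_bigr _ (fun k _ => zE k)) !coef_sum.
have aE k u w : ((v (enum_rank (k, u)) * v (enum_rank (k, w)))%:P%:P *
    (c k * (mon (nat2 u) * mon (nat2 w))))`_l`_l' =
    v (enum_rank (k, u)) * v (enum_rank (k, w)) *
    (c k * (mon (nat2 u) * mon (nat2 w)))`_l`_l' by rewrite !coefCM.
have [/andP[lE lE']|lE] := boolP ((l < E) && (l' < E))%N; last first.
  apply: big1 => k _; rewrite !coef_sum; apply: big1 => u _.
  rewrite !coef_sum; apply: big1 => w _; rewrite aE coef2_mon.
  case: ifP => _; rewrite ?mulr0 // cs ?mulr0 //.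
  move: lE; rewrite negb_and -!leqNgt /nat2 /= /E.
  case: u w => [u1 u2] [w1 w2] /=.
  move: (ltn_ord u1) (ltn_ord u2) (ltn_ord w1) (ltn_ord w2) => ? ? ? ?.
  by case/orP => ?; apply/orP; [left|right]; lia.
have := fv0 (enum_rank (Ordinal lE, Ordinal lE')).
apply: etrans; rewrite /f raddf_sum enum_rankK; apply: eq_bigr => k _.
rewrite !coef_sum raddf_sum; apply: eq_bigr => u _.
rewrite !coef_sum raddf_sum; apply: eq_bigr => w _.
by rewrite aE /= mevalZ mevalM !mevalXU /a /= mulrC.
Qed.

End QuadraticForms.

(** * Twofold Pfister forms *)

Section TwofoldPfister.
Variable F : fieldType.
Hypothesis two_neq0 : (2 : F) != 0.
Implicit Types p q c g x y z w : F.

Definition pfister p q x y z w := x ^+ 2 + p * y ^+ 2 + q * z ^+ 2 + p * q * w ^+ 2.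

Definition represents p q c := exists x y z w, c = pfister p q x y z w.

Lemma represents_sqr p q x : represents p q (x ^+ 2).
Proof. by exists x, 0, 0, 0; rewrite /pfister; ring. Qed.

Lemma represents_swap p q c : represents p q c -> represents q p c.
Proof. by move=> [x [y [z [w ->]]]]; exists x, z, y, w; rewrite /pfister; ring. Qed.

(** The form is the norm of the quaternion algebra with i^2 = -p and j^2 = -q; the witnesses are the
    coordinates of a product of two quaternions. *)
Lemma represents_mul p q c c' :
  represents p q c -> represents p q c' -> represents p q (c * c').
Proof.
move=> [x [y [z [w ->]]]] [x' [y' [z' [w' ->]]]].
exists (x * x' - p * y * y' - q * z * z' - p * q * w * w').
exists (x * y' + y * x' + q * (z * w' - w * z')).
exists (x * z' + z * x' + p * (w * y' - y * w')).
exists (x * w' + w * x' + y * z' - z * y').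
by rewrite /pfister; ring.
Qed.

Lemma represents_inv p q c : represents p q c -> represents p q c^-1.
Proof.
have [->|c0] := eqVneq c 0; first by rewrite invr0.
have -> : c^-1 = c * (c^-1) ^+ 2 by field.
by move=> /represents_mul; apply; apply: represents_sqr.
Qed.

Lemma represents_sqr_mulr p q x c :
  x != 0 -> represents p q (c * x ^+ 2) -> represents p q c.
Proof.
move=> x0 h; have -> : c = (c * x ^+ 2) * (x^-1) ^+ 2 by field.
exact/represents_mul/represents_sqr.
Qed.

(** The form <1, q> is multiplicative, so the factor y^2 + q z^2 can be absorbed into the second and
    fourth variables. *)
Lemma represents_scale p q y z c :
  represents (p * (y ^+ 2 + q * z ^+ 2)) q c -> represents p q c.
Proof.
move=> [s [t [u [v ->]]]].
by exists s, (y * t - q * z * v), u, (y * v + z * t); rewrite /pfister; ring.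
Qed.

(** On the line through a basis vector in the direction of the isotropic vector, the form is affine
    in the parameter [l]. Its slope is nonzero when the basis vector belongs to a nonzero
    coordinate, so every value [c] is reached. *)
Lemma isotropic_universal p q x y z w c :
  p != 0 -> q != 0 -> pfister p q x y z w = 0 ->
  [|| x != 0, y != 0, z != 0 | w != 0] -> represents p q c.
Proof.
rewrite /pfister => p0 q0 e /or4P[] n0.
- pose l := (c - 1) / (2 * x); exists (1 + l * x), (l * y), (l * z), (l * w).
  transitivity (1 + 2 * l * x + l ^+ 2 * pfister p q x y z w); last by rewrite /pfister; ring.
  by rewrite /pfister e /l; field; rewrite n0.
- pose l := (c - p) / (2 * p * y); exists (l * x), (1 + l * y), (l * z), (l * w).
  transitivity (p + 2 * p * l * y + l ^+ 2 * pfister p q x y z w); last by rewrite /pfister; ring.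
  by rewrite /pfister e /l; field; rewrite n0 p0.
- pose l := (c - q) / (2 * q * z); exists (l * x), (l * y), (1 + l * z), (l * w).
  transitivity (q + 2 * q * l * z + l ^+ 2 * pfister p q x y z w); last by rewrite /pfister; ring.
  by rewrite /pfister e /l; field; rewrite n0 q0.
- pose l := (c - p * q) / (2 * p * q * w).
  exists (l * x), (l * y), (l * z), (1 + l * w).
  transitivity (p * q + 2 * p * q * l * w + l ^+ 2 * pfister p q x y z w);
    last by rewrite /pfister; ring.
  by rewrite /pfister e /l; field; rewrite n0 p0 q0.
Qed.

(* If b = g + p and g = N1 - b p N2 with N1, N2 values of <1, q>, then
   b (1 + p N2) = N1 + p, a quotient of two values of the form. *)
Lemma represents_add p q g : p != 0 -> q != 0 ->
  represents (- (g + p) * p) q g -> represents p q (g + p).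
Proof.
move=> p0 q0 [s [u [t [v gE]]]].
pose N1 := s ^+ 2 + q * t ^+ 2; pose N2 := u ^+ 2 + q * v ^+ 2.
have e : (g + p) * (1 + p * N2) = N1 + p.
  apply/eqP; rewrite -subr_eq0.
  have -> : (g + p) * (1 + p * N2) - (N1 + p) = g - pfister (- (g + p) * p) q s u t v.
    by rewrite /N1 /N2 /pfister; ring.
  by rewrite -gE subrr.
have [n0|n0] := eqVneq (1 + p * N2) 0.
  apply: (@isotropic_universal p q 1 u 0 v) => //; last by rewrite oner_eq0.
  by rewrite -[RHS]n0 /pfister /N2; ring.
have -> : g + p = (N1 + p) * (1 + p * N2)^-1 by rewrite -e mulfK.
apply: represents_mul.
  by exists s, 1, t, 0; rewrite /pfister /N1; ring.
by apply: represents_inv; exists 1, u, 0, v; rewrite /pfister /N2; ring.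
Qed.

Lemma represents_sum_squares :
  (forall p q x y, p != 0 -> q != 0 -> represents p q (x ^+ 2 + y ^+ 2)) ->
  forall (s : seq F) p q, p != 0 -> q != 0 -> represents p q (\sum_(x <- s) x ^+ 2).
Proof.
move=> rep2; elim=> [|x s IHs] a b a0 b0.
  by rewrite big_nil -[0](expr0n _ 2); apply: represents_sqr.
have rep0 p q : represents p q 0 by rewrite -[0](expr0n _ 2); apply: represents_sqr.
(* [represents_add] asks for a form whose first entry depends on [g]; it becomes usable when [g] is
   represented whatever that entry is. *)
have add p q g : p != 0 -> q != 0 ->
    (forall p', p' != 0 -> represents p' q g) -> represents p q (g + p).
  move=> p0 q0 repg; have [->|gp0] := eqVneq (g + p) 0; first exact: rep0.
  by apply: represents_add => //; apply: repg; rewrite mulf_neq0 // oppr_eq0.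
rewrite big_cons; have [y [y1 [z [w ->]]]] := IHs a b a0 b0.
(* Here [p] is [a] times a value of <1, b>, so <<p, b>> can stand for <<a, b>>. The same method,
   with the entries swapped and b z^2 as the added entry, deals with [g]. *)
pose g := x ^+ 2 + y ^+ 2 + b * z ^+ 2; pose p := a * (y1 ^+ 2 + b * w ^+ 2).
have -> : x ^+ 2 + pfister a b y y1 z w = g + p by rewrite /pfister /g /p; ring.
have repg d : d != 0 -> represents d b g.
  move=> d0; apply: represents_swap; have [z0|z0] := eqVneq z 0.
    by rewrite /g z0 expr0n mulr0 addr0; apply: rep2.
  apply: (@represents_scale _ _ z 0); rewrite expr0n mulr0 addr0.
  apply: add => //; first by rewrite mulf_neq0 ?expf_neq0.
  by move=> p' p'0; apply: represents_swap; apply: rep2.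
have [->|p0] := eqVneq p 0; first by rewrite addr0; apply: repg.
by apply: (@represents_scale _ _ y1 w); rewrite -/p; apply: add.
Qed.

Definition pfister_dot p q x y z w x' y' z' w' :=
  x * x' + p * (y * y') + q * (z * z') + p * q * (w * w').

(* With u, v in the quaternion algebra, the norm of u + i v over F(i) is
   (N v - N u)^2 + 4 B(u, v)^2 = N ((N v - N u) + 2 B(u, v) u v^-1). *)
Lemma represents_norm_square p q x y z w x' y' z' w' :
  p != 0 -> q != 0 ->
  represents p q ((pfister p q x y z w - pfister p q x' y' z' w') ^+ 2 +
                  (2 * pfister_dot p q x y z w x' y' z' w') ^+ 2).
Proof.
move=> p0 q0; set U := pfister p q x y z w; set V := pfister _ _ x' _ _ _.
set B := pfister_dot _ _ _ _ _ _ _ _ _ _.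
have [V0|V0] := eqVneq V 0.
  have [n|] := boolP [|| x' != 0, y' != 0, z' != 0 | w' != 0].
    exact: isotropic_universal V0 n.
  rewrite !negb_or !negbK => /and4P[/eqP x0 /eqP y0 /eqP z0 /eqP w0].
  have -> : B = 0 by rewrite /B /pfister_dot x0 y0 z0 w0; ring.
  by rewrite V0 subr0 mulr0 expr0n addr0; apply: represents_sqr.
pose a := V - U; pose b := 2 * B / V.
pose s2 := y * x' - x * y' - q * (z * w' - w * z').
pose s3 := z * x' - x * z' - p * (w * y' - y * w').
pose s4 := w * x' - x * w' - y * z' + z * y'.
exists (a + b * B), (b * s2), (b * s3), (b * s4).
have s_norm : B ^+ 2 + p * s2 ^+ 2 + q * s3 ^+ 2 + p * q * s4 ^+ 2 = U * V.
  by rewrite /B /s2 /s3 /s4 /U /V /pfister /pfister_dot; ring.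
transitivity (a ^+ 2 + 2 * a * b * B + b ^+ 2 * (U * V)).
  by rewrite /a /b; field.
by rewrite -s_norm /pfister; ring.
Qed.

(** If v has nonzero norm, u v^-1 is a pure quaternion of norm 1, so a + b u v^-1 has norm a^2 +
    b^2; [s2], [s3], [s4] are the coordinates of u times the conjugate of v. Otherwise the form is
    isotropic. *)
Lemma represents_orthogonal p q x y z w x' y' z' w' a b :
  p != 0 -> q != 0 ->
  pfister p q x y z w = pfister p q x' y' z' w' ->
  pfister_dot p q x y z w x' y' z' w' = 0 ->
  [|| x != 0, y != 0, z != 0 | w != 0] || [|| x' != 0, y' != 0, z' != 0 | w' != 0] ->
  represents p q (a ^+ 2 + b ^+ 2).
Proof.
move=> p0 q0 UV B0 n.
have [V0|V0] := eqVneq (pfister p q x' y' z' w') 0.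
  case/orP: n => n; last exact: isotropic_universal V0 n.
  by rewrite V0 in UV; exact: isotropic_universal UV n.
pose V := pfister p q x' y' z' w'.
pose s2 := y * x' - x * y' - q * (z * w' - w * z').
pose s3 := z * x' - x * z' - p * (w * y' - y * w').
pose s4 := w * x' - x * w' - y * z' + z * y'.
exists a, (b * s2 / V), (b * s3 / V), (b * s4 / V).
have s_norm : p * s2 ^+ 2 + q * s3 ^+ 2 + p * q * s4 ^+ 2 = V ^+ 2.
  transitivity (pfister p q x y z w * V - pfister_dot p q x y z w x' y' z' w' ^+ 2).
    by rewrite /s2 /s3 /s4 /V /pfister /pfister_dot; ring.
  by rewrite UV B0 /V; ring.
transitivity (a ^+ 2 + b ^+ 2 * (V ^+ 2) / V ^+ 2); first by field.
by rewrite -[X in _ * X / _]s_norm /pfister; field.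
Qed.

End TwofoldPfister.

(** * Sums of two squares in R(X, Y) *)

Lemma fraction_quotient (A : idomainType) (f : {fraction A}) :
  exists a b : A, b != 0 /\ f = FracField.tofrac a / FracField.tofrac b.
Proof.
elim/quotW: f => r; exists (\n_r), (\d_r); split; first exact: denom_ratioP.
have d0 : FracField.tofrac \d_r != 0 by rewrite tofrac_eq0 denom_ratioP.
apply: (mulIf d0); rewrite divfK //.
rewrite !piE; apply/eqmodP => /=.
rewrite /= FracField.equivfE /FracField.mulf !numden_Ratio ?mulr1 ?oner_eq0 ?denom_ratioP //.
by rewrite mulrC.
Qed.

(** [B] is [A] with a square root of -1 adjoined. As a property of a ring map, it passes
    coefficientwise to polynomials, twice for R[X][Y]. *)
Definition complexification (A B : comNzRingType) (iota : A -> B) (i : B) : Prop :=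
  [/\ i ^+ 2 = -1, forall z, exists a b, z = iota a + i * iota b
    & forall a b, iota a + i * iota b = 0 -> a = 0 /\ b = 0].

Lemma complexification_poly (A B : comNzRingType) (iota : {rmorphism A -> B}) (i : B) :
  complexification iota i -> complexification (map_poly iota) i%:P.
Proof.
move=> [i2 dec inj]; split.
- by rewrite -rmorphXn /= i2 rmorphN1.
- move=> z; have [re /choice [im e]] := choice dec.
  exists (\poly_(k < size z) re z`_k), (\poly_(k < size z) im z`_k).
  apply/polyP => k; rewrite coefD coefCM !coef_map !coef_poly /=.
  case: ltnP => zk; first exact: e.
  by rewrite rmorph0 mulr0 addr0 nth_default.
- move=> a b /polyP e.
  have ab k : a`_k = 0 /\ b`_k = 0.
    by apply: inj; have := e k; rewrite coefD coefCM !coef_map coef0.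
  by split; apply/polyP => k; rewrite coef0; case: (ab k).
Qed.

Lemma complexification_complex (R : rcfType) :
  complexification (real_complex R) ('i%C : R[i]).
Proof.
split.
- by rewrite sqr_i.
- by move=> [a b]; exists a, b; simpc.
- by move=> a b; simpc => -[-> ->].
Qed.

Definition sum2_anisotropic (A : pzRingType) : Prop :=
  forall a b : A, a ^+ 2 + b ^+ 2 = 0 -> a = 0 /\ b = 0.

Lemma sum2_anisotropic_real (R : realDomainType) : sum2_anisotropic R.
Proof.
move=> a b /eqP; rewrite paddr_eq0 ?sqr_ge0 // !sqrf_eq0.
by case/andP => /eqP -> /eqP ->.
Qed.

Lemma sum2_anisotropic_poly (A : idomainType) :
  sum2_anisotropic A -> sum2_anisotropic {poly A}.
Proof.
move=> an; have half (a b : {poly A}) : a ^+ 2 + b ^+ 2 = 0 -> a = 0.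
  move=> e; have eb : a ^+ 2 = - b ^+ 2 by apply/eqP; rewrite -addr_eq0 e.
  have : lead_coef a ^+ 2 + lead_coef b ^+ 2 = 0.
    by rewrite -!lead_coef_exp eb lead_coefN addNr.
  by move=> /an [/eqP]; rewrite lead_coef_eq0 => /eqP.
move=> a b e; split; first exact: half e.
by apply: (half b a); rewrite addrC.
Qed.


Section IsotropicComplexification.
Variables (A : idomainType) (K : fieldType) (f : {rmorphism A -> K}).
Hypothesis f_inj : forall a, (f a == 0) = (a == 0).
Hypothesis anisotropic : sum2_anisotropic A.
Hypothesis two_neq0 : (2 : K) != 0.

(* The hypotheses say that the u_k + i v_k form a nontrivial zero of
   <1, p, q, p q, - (x + i y)>. *)
Lemma represents_sum2_of_zero (p q x y u0 u1 u2 u3 u4 v0 v1 v2 v3 v4 : A) :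
  p != 0 -> q != 0 ->
  pfister (f p) (f q) (f u0) (f u1) (f u2) (f u3) -
    pfister (f p) (f q) (f v0) (f v1) (f v2) (f v3) =
    f (x * (u4 ^+ 2 - v4 ^+ 2) - 2 * y * u4 * v4) ->
  2 * pfister_dot (f p) (f q) (f u0) (f u1) (f u2) (f u3) (f v0) (f v1) (f v2) (f v3) =
    f (2 * x * u4 * v4 + y * (u4 ^+ 2 - v4 ^+ 2)) ->
  [|| u0 != 0, u1 != 0, u2 != 0 | u3 != 0] || [|| v0 != 0, v1 != 0, v2 != 0 | v3 != 0]
    || (u4 != 0) || (v4 != 0) ->
  represents (f p) (f q) (f x ^+ 2 + f y ^+ 2).
Proof.
move=> p0 q0; set U := pfister _ _ (f u0) _ _ _; set V := pfister _ _ (f v0) _ _ _.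
set D := pfister_dot _ _ _ _ _ _ _ _ _ _ => UVE DE nz.
have fp : f p != 0 by rewrite f_inj.
have fq : f q != 0 by rewrite f_inj.
(* If the last coordinate vanishes, <1, p, q, p q> itself has a complex zero: u and v are orthogonal
   and of equal length. *)
have [/andP[/eqP u40 /eqP v40]|] := boolP ((u4 == 0) && (v4 == 0)).
  have UV : U = V.
    apply/eqP; rewrite -subr_eq0 UVE u40 v40.
    by rewrite expr0n !mulr0 subrr mulr0 subrr rmorph0.
  have D0 : D = 0.
    apply/eqP; rewrite -(mulrI_eq0 _ (mulfI two_neq0)) DE u40 v40.
    by rewrite expr0n !mulr0 subrr mulr0 addr0 rmorph0.
  move: nz; rewrite u40 v40 eqxx !orbF => nz.
  by apply: (represents_orthogonal two_neq0 _ _ fp fq UV D0); rewrite !f_inj.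
move=> uv4; have s0 : f (u4 ^+ 2 + v4 ^+ 2) != 0.
  by rewrite f_inj; apply: contraNneq uv4 => /anisotropic [-> ->]; rewrite eqxx.
apply: (represents_sqr_mulr s0).
(* Norms on both sides of (U - V) + 2 i D = (x + i y) (u4 + i v4)^2. *)
have -> : (f x ^+ 2 + f y ^+ 2) * f (u4 ^+ 2 + v4 ^+ 2) ^+ 2 =
    (U - V) ^+ 2 + (2 * D) ^+ 2.
  by rewrite UVE DE !(rmorphB, rmorphD, rmorphM, rmorphXn, rmorph_nat); ring.
exact: (represents_norm_square two_neq0).
Qed.

End IsotropicComplexification.

Lemma represents_clear_denominators (K : fieldType) (p q b d c : K) :
  b != 0 -> d != 0 -> represents (p * b ^+ 2) (q * d ^+ 2) c -> represents p q c.
Proof.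
move=> b0 d0 h; apply: (@represents_scale _ _ _ b 0).
rewrite expr0n mulr0 addr0; apply: represents_swap.
apply: (@represents_scale _ _ _ d 0); rewrite expr0n mulr0 addr0.
exact: represents_swap.
Qed.

Lemma represents_sum2_quotients (A : idomainType) (K : fieldType) (f : {rmorphism A -> K}) :
  (forall a, (f a == 0) = (a == 0)) ->
  (forall p q x y : A, p != 0 -> q != 0 -> represents (f p) (f q) (f x ^+ 2 + f y ^+ 2)) ->
  forall pn pd qn qd xn xd yn yd : A,
  pd != 0 -> qd != 0 -> xd != 0 -> yd != 0 -> f pn / f pd != 0 -> f qn / f qd != 0 ->
  represents (f pn / f pd) (f qn / f qd) ((f xn / f xd) ^+ 2 + (f yn / f yd) ^+ 2).
Proof.
move=> f_inj rep2 pn pd qn qd xn xd yn yd pd0 qd0 xd0 yd0.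
rewrite !mulf_eq0 !invr_eq0 !f_inj !negb_or => /andP[pn0 _] /andP[qn0 _].
have f0 a : a != 0 -> f a != 0 by rewrite f_inj.
apply: (represents_clear_denominators (f0 _ pd0) (f0 _ qd0)).
have clear a b : b != 0 -> f a / f b * f b ^+ 2 = f (a * b).
  by move=> /f0 b0; rewrite rmorphM; field.
rewrite !clear //.
apply: (@represents_sqr_mulr _ _ _ (f (xd * yd))); first by rewrite f_inj mulf_neq0.
have -> : ((f xn / f xd) ^+ 2 + (f yn / f yd) ^+ 2) * f (xd * yd) ^+ 2 =
    f (xn * yd) ^+ 2 + f (yn * xd) ^+ 2.
  by rewrite !rmorphM; field; rewrite !f0.
by apply: rep2; rewrite mulf_neq0.
Qed.

Section BivariateFractions.
Variable R : rcfType.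
Local Notation PP := {poly {poly R}}.
Local Notation tofrac := (@FracField.tofrac PP).

Lemma fraction_char0 : (2 : {fraction PP}) != 0.
Proof.
have -> : (2 : {fraction PP}) = tofrac 2%:P%:P by rewrite /= !rmorph_nat.
by rewrite tofrac_eq0 !polyC_eq0 pnatr_eq0.
Qed.

Lemma represents_sum2_poly (p q x y : PP) : p != 0 -> q != 0 ->
  represents (tofrac p) (tofrac q) (tofrac x ^+ 2 + tofrac y ^+ 2).
Proof.
move=> p0 q0.
pose iota : {rmorphism PP -> {poly {poly R[i]}}} := map_poly (map_poly (real_complex R)).
have [i2 dec inj] : complexification iota ('i%C : R[i])%:P%:P.
  by do 2 apply: complexification_poly; exact: complexification_complex.
move: (_%:P%:P) i2 dec inj => i i2 dec inj.
pose c := tnth [tuple 1; iota p; iota q; iota (p * q); - (iota x + i * iota y)].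
have [z [zE [k zk]]] := quadratic_form_isotropic_bivariate c (isT : (4 < 5)%N).
have [z0 [z1 [z2 [z3 [z4 [zE0 nz]]]]]] : exists z0 z1 z2 z3 z4,
    z0 ^+ 2 + iota p * z1 ^+ 2 + iota q * z2 ^+ 2 + iota (p * q) * z3 ^+ 2 =
    (iota x + i * iota y) * z4 ^+ 2
    /\ [|| z0 != 0, z1 != 0, z2 != 0, z3 != 0 | z4 != 0].
  move: zE; rewrite !big_ord_recl big_ord0 /c !(tnth_nth 0) /= mul1r addr0 => zE.
  exists (z ord0), (z (lift ord0 ord0)), (z (lift ord0 (lift ord0 ord0))).
  exists (z (lift ord0 (lift ord0 (lift ord0 ord0)))).
  exists (z (lift ord0 (lift ord0 (lift ord0 (lift ord0 ord0))))).
  split; first by apply/eqP; rewrite -subr_eq0 -[X in _ == X]zE; apply/eqP; ring.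
  have : [exists (k | true), z k != 0] by apply/existsP; exists k.
  by rewrite -big_orE !big_ord_recl big_ord0 orbF.
have [u0 [v0 e0]] := dec z0; have [u1 [v1 e1]] := dec z1.
have [u2 [v2 e2]] := dec z2; have [u3 [v3 e3]] := dec z3.
have [u4 [v4 e4]] := dec z4.
pose A := x * (u4 ^+ 2 - v4 ^+ 2) - 2 * y * u4 * v4.
pose B := 2 * x * u4 * v4 + y * (u4 ^+ 2 - v4 ^+ 2).
pose phi (a b c d : PP) := a ^+ 2 + p * b ^+ 2 + q * c ^+ 2 + p * q * d ^+ 2.
pose dot := u0 * v0 + p * (u1 * v1) + q * (u2 * v2) + p * q * (u3 * v3).
have [reE imE] : phi u0 u1 u2 u3 - phi v0 v1 v2 v3 - A = 0 /\ 2 * dot - B = 0.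
  apply: inj; rewrite /phi /dot /A /B.
  rewrite !(rmorphB, rmorphD, rmorphM, rmorphXn, rmorph_nat) /=.
  have ii : i * i = -1 by rewrite -expr2.
  move/eqP: zE0; rewrite -subr_eq0 e0 e1 e2 e3 e4 rmorphM => /eqP <-.
  by ring: i2.
apply: (@represents_sum2_of_zero PP _ tofrac (@tofrac_eq0 PP) _ fraction_char0
  p q x y u0 u1 u2 u3 u4 v0 v1 v2 v3 v4 p0 q0).
- by do 2 apply: sum2_anisotropic_poly; exact: sum2_anisotropic_real.
- rewrite -/A -(subr0_eq reE) /phi /pfister.
  by rewrite !(rmorphB, rmorphD, rmorphM, rmorphXn).
- rewrite -/B -(subr0_eq imE) /dot /pfister_dot.
  by rewrite !(rmorphB, rmorphD, rmorphM, rmorphXn, rmorph_nat).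
apply: contraLR nz; rewrite !negb_or !negbK -!andbA.
case/and5P => /eqP a0 /eqP a1 /eqP a2 /eqP a3 /and5P[/eqP b0 /eqP b1 /eqP b2 /eqP b3].
case/andP=> /eqP a4 /eqP b4.
by rewrite e0 e1 e2 e3 e4 a0 a1 a2 a3 a4 b0 b1 b2 b3 b4 !rmorph0 mulr0 addr0 eqxx.
Qed.

Lemma represents_sum2 (p q x y : {fraction PP}) : p != 0 -> q != 0 ->
  represents p q (x ^+ 2 + y ^+ 2).
Proof.
have [pn [pd [pd0 ->]]] := fraction_quotient p.
have [qn [qd [qd0 ->]]] := fraction_quotient q.
have [xn [xd [xd0 ->]]] := fraction_quotient x.
have [yn [yd [yd0 ->]]] := fraction_quotient y.
exact: (represents_sum2_quotients (@tofrac_eq0 PP) represents_sum2_poly).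
Qed.

Theorem sum_squares_represented (s : seq {fraction PP}) (p q : {fraction PP}) :
  p != 0 -> q != 0 -> represents p q (\sum_(x <- s) x ^+ 2).
Proof. exact: (represents_sum_squares fraction_char0 represents_sum2). Qed.

End BivariateFractions.

(** * Preorderings and real closures *)

Section Preordering.
Variable Omega : fieldType.
Implicit Types (T : set Omega) (a b : Omega).

Definition span_sub T a := exists t s, [/\ T t, T s & a = t - s].

(* A preordering of the subfield T - T. *)
Record preordering T : Prop := Preordering {
  preordering0 : T 0;
  preordering1 : T 1;
  preorderingD : forall a b, T a -> T b -> T (a + b);
  preorderingM : forall a b, T a -> T b -> T (a * b);
  preorderingN1 : ~ T (-1);
  preordering_sqr : forall a, span_sub T a -> T (a ^+ 2);
  preorderingV : forall a, span_sub T a -> span_sub T a^-1 }.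

(** Maximal among the preorderings of all subfields of [Omega]. A larger [T] may mean more positive
    elements in the same subfield, whence totality, or a larger subfield, whence real closedness. *)
Definition max_preordering T :=
  preordering T /\ forall T', preordering T' -> (T `<=` T')%classic -> (T' `<=` T)%classic.

Lemma max_preordering_exists T0 : preordering T0 ->
  exists2 T, max_preordering T & (T0 `<=` T)%classic.
Proof.
(* The union with [T0] takes care of the empty chain. *)
move=> pT0; pose P (J : set Omega) := preordering (J `|` T0)%classic.
have [|J [PJ maxJ]] := @Zorn_bigcup Omega P; last first.
  exists (J `|` T0)%classic; last by move=> x; right.
  split=> // T' pT' JT'; apply: contrapT => T'J.
  have T'T0 : (T' `|` T0)%classic = T'.
    by apply/seteqP; split=> x; [case=> // ?; apply: JT'; right|left].
  apply: (maxJ T'); last by rewrite /P T'T0.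
  split; first by move=> x Jx; apply: JT'; left.
  by move=> T'J'; apply: T'J => x /T'J'; left.
move=> F FP tot; rewrite /P; set W := (_ `|` _)%classic.
have up J a : F J -> (J `|` T0)%classic a -> W a.
  by move=> FJ [Ja|Ta]; [left; exists J|right].
have two a b : W a -> W b ->
    exists2 Q, preordering Q & (Q `<=` W)%classic /\ Q a /\ Q b.
  move=> Wa Wb; have [[J [FJ Ja]]|Ja] := pselect (exists J, F J /\ J a).
    have [[K [FK Kb]]|Kb] := pselect (exists J, F J /\ J b).
      have [JK|KJ] := tot _ _ FJ FK.
        exists (K `|` T0)%classic; first exact: FP.
        by split; [move=> ?; apply: up|split; left => //; apply: JK].
      exists (J `|` T0)%classic; first exact: FP.
      by split; [move=> ?; apply: up|split; left => //; apply: KJ].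
    exists (J `|` T0)%classic; first exact: FP.
    split; [by move=> ?; apply: up|split; [by left|right]].
    by case: Wb => // -[K FK Kb']; case: Kb; exists K.
  have T0a : T0 a by case: Wa => // -[K FK Ka]; case: Ja; exists K.
  have [[K [FK Kb]]|Kb] := pselect (exists J, F J /\ J b).
    exists (K `|` T0)%classic; first exact: FP.
    by split; [move=> ?; apply: up|split; [right|left]].
  have T0b : T0 b by case: Wb => // -[K FK Kb']; case: Kb; exists K.
  by exists T0 => //; split => // x; right.
have spanW Q a : (Q `<=` W)%classic -> span_sub Q a -> span_sub W a.
  by move=> QW [t [s [Qt Qs ->]]]; exists t, s; split => //; apply: QW.
have span2 a : span_sub W a ->
    exists2 Q, preordering Q & (Q `<=` W)%classic /\ span_sub Q a.
  move=> [t [s [Wt Ws ->]]]; have [Q pQ [QW [Qt Qs]]] := two _ _ Wt Ws.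
  by exists Q => //; split => //; exists t, s.
split.
- by right; apply: preordering0.
- by right; apply: preordering1.
- by move=> a b Wa Wb; have [Q pQ [QW [Qa Qb]]] := two _ _ Wa Wb;
    apply: QW; apply: preorderingD.
- by move=> a b Wa Wb; have [Q pQ [QW [Qa Qb]]] := two _ _ Wa Wb;
    apply: QW; apply: preorderingM.
- by move=> W1; have [Q pQ [QW [Q1 _]]] := two _ _ W1 W1; case: (preorderingN1 pQ).
- by move=> a /span2 [Q pQ [QW Qa]]; apply: QW; apply: preordering_sqr.
- by move=> a /span2 [Q pQ [QW Qa]]; apply: (spanW Q) => //; apply: preorderingV.
Qed.

Variable T : set Omega.
Hypothesis pT : preordering T.

Lemma span_sub_sub a b : span_sub T a -> span_sub T b -> span_sub T (a - b).
Proof.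
move=> [t [s [Tt Ts ->]]] [t' [s' [Tt' Ts' ->]]].
by exists (t + s'), (s + t'); split; [exact: preorderingD|exact: preorderingD|ring].
Qed.

Lemma span_sub_mul a b : span_sub T a -> span_sub T b -> span_sub T (a * b).
Proof.
move=> [t [s [Tt Ts ->]]] [t' [s' [Tt' Ts' ->]]].
exists (t * t' + s * s'), (s * t' + t * s').
by split; [apply: preorderingD => //; exact: preorderingM
  |apply: preorderingD => //; exact: preorderingM|ring].
Qed.

Lemma span_sub_sup a : T a -> span_sub T a.
Proof. by move=> Ta; exists a, 0; rewrite subr0; split => //; exact: preordering0. Qed.

Lemma span_sub1 : span_sub T 1.
Proof. exact: span_sub_sup (preordering1 pT). Qed.

Lemma preordering_anti a : T a -> T (- a) -> a = 0.
Proof.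
move=> Ta TNa; apply: contrapT => /eqP a0; case: (preorderingN1 pT).
have -> : -1 = a * (- a) * (a^-1) ^+ 2 by field.
apply: preorderingM => //; first exact: preorderingM.
by apply: (preordering_sqr pT); apply: (preorderingV pT); apply: span_sub_sup.
Qed.

End Preordering.

(** If [a] is not in [T], then T - a T is a preordering of the same subfield: -1 = t - a s would
    give a = (1 + t) s (s^-1)^2, an element of [T]. It contains -a, and by maximality it is [T]. *)
Lemma max_preordering_total (Omega : fieldType) (T : set Omega) a :
  max_preordering T -> span_sub T a -> T a \/ T (- a).
Proof.
move=> [pT maxT] Sa; have [|nTa] := pselect (T a); first by left.
right; pose T' : set Omega := fun x => exists t s, [/\ T t, T s & x = t - a * s].
have TT' : (T `<=` T')%classic.
  move=> x Tx; exists x, 0; rewrite mulr0 subr0; split => //; exact: preordering0.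
have T'S x : T' x -> span_sub T x.
  move=> [t [s [Tt Ts ->]]]; apply: span_sub_sub => //; first exact: span_sub_sup.
  by apply: span_sub_mul => //; exact: span_sub_sup.
have S'S x : span_sub T' x -> span_sub T x.
  by move=> [t [s [/T'S ? /T'S ? ->]]]; apply: span_sub_sub.
apply: (maxT T') => //; last first.
  by exists 0, 1; rewrite mulr1 sub0r; split => //; [exact: preordering0|exact: preordering1].
split.
- by apply: TT'; apply: preordering0.
- by apply: TT'; apply: preordering1.
- move=> _ _ [t [s [Tt Ts ->]]] [t' [s' [Tt' Ts' ->]]].
  by exists (t + t'), (s + s'); split; [exact: preorderingD|exact: preorderingD|ring].
- move=> _ _ [t [s [Tt Ts ->]]] [t' [s' [Tt' Ts' ->]]].
  exists (t * t' + a ^+ 2 * (s * s')), (t * s' + s * t'); split; last by ring.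
    apply: preorderingD; rewrite //; apply: preorderingM => //.
      exact: preordering_sqr.
    exact: preorderingM.
  by apply: preorderingD => //; apply: preorderingM.
- move=> [t [s [Tt Ts e]]]; apply: nTa.
  have s0 : s != 0.
    by apply: contraPneq Tt => s0; rewrite -[t](subrK (a * s)) -e s0 mulr0 addr0;
      exact: preorderingN1.
  have -> : a = (1 + t) * s * (s^-1) ^+ 2.
    have -> : t = a * s - 1 by rewrite e; ring.
    by field.
  apply: preorderingM => //; first by apply: preorderingM => //;
    apply: preorderingD => //; exact: preordering1.
  by apply: (preordering_sqr pT); apply: (preorderingV pT); apply: span_sub_sup.
- by move=> x /S'S /(preordering_sqr pT); apply: TT'.
- move=> x /S'S /(preorderingV pT) [t [s [Tt Ts ->]]].
  by exists t, s; split => //; apply: TT'.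
Qed.

Section MaxPreorderingField.
Variables (Omega : fieldType) (T : set Omega).

(** Maximality is an argument so that the structures resting on it can be attached to the predicate
    and to the subfield. *)
Definition span_pred & max_preordering T : {pred Omega} := fun x => `[< span_sub T x >].

Variable maxT : max_preordering T.
Let pT : preordering T := proj1 maxT.

Lemma span_predP x : reflect (span_sub T x) (x \in span_pred maxT).
Proof. exact: asboolP. Qed.

Lemma span_pred_divring : divring_closed (span_pred maxT).
Proof.
split.
- exact/span_predP/span_sub1.
- by move=> x y /span_predP Sx /span_predP Sy; apply/span_predP/span_sub_sub.
- move=> x y /span_predP Sx /span_predP Sy.
  by apply/span_predP/span_sub_mul => //; apply: (preorderingV pT).
Qed.

HB.instance Definition _ := GRing.isDivringClosed.Build Omega (span_pred maxT)
  span_pred_divring.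

Definition ordered_subfield : Type := {x : Omega | x \in span_pred maxT}.

HB.instance Definition _ := [isSub of ordered_subfield for @sval _ _].
HB.instance Definition _ := [Choice of ordered_subfield by <:].
HB.instance Definition _ := [SubChoice_isSubIntegralDomain of ordered_subfield by <:].
HB.instance Definition _ := [SubIntegralDomain_isSubField of ordered_subfield by <:].

Local Notation M := ordered_subfield.

Definition osub_le (x y : M) : bool := `[< T (val y - val x) >].
Definition osub_norm (x : M) : M := if osub_le 0 x then x else - x.

Lemma osub_le0 x : osub_le 0 x = `[< T (val x) >].
Proof. by rewrite /osub_le rmorph0 subr0. Qed.

Lemma osub_le0_add x y : osub_le 0 x -> osub_le 0 y -> osub_le 0 (x + y).
Proof.
rewrite !osub_le0 rmorphD => /asboolP Tx /asboolP Ty; apply/asboolP.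
exact: (preorderingD pT).
Qed.

Lemma osub_le0_mul x y : osub_le 0 x -> osub_le 0 y -> osub_le 0 (x * y).
Proof.
rewrite !osub_le0 rmorphM => /asboolP Tx /asboolP Ty; apply/asboolP.
exact: (preorderingM pT).
Qed.

Lemma osub_le0_anti x : osub_le 0 x -> osub_le x 0 -> x = 0.
Proof.
rewrite osub_le0 /osub_le rmorph0 sub0r => /asboolP Tx /asboolP TNx.
by apply/val_inj; rewrite rmorph0; apply: (preordering_anti pT).
Qed.

Lemma osub_sub_ge0 x y : osub_le 0 (y - x) = osub_le x y.
Proof. by rewrite osub_le0 rmorphB. Qed.

Lemma osub_le0_total x : osub_le 0 x || osub_le x 0.
Proof.
rewrite osub_le0 /osub_le rmorph0 sub0r.
have /span_predP Sx := valP x.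
by have [Tx|TNx] := max_preordering_total maxT Sx; apply/orP;
  [left|right]; apply/asboolP.
Qed.

Lemma osub_normN x : osub_norm (- x) = osub_norm x.
Proof.
rewrite /osub_norm opprK.
have -> : osub_le 0 (- x) = osub_le x 0 by rewrite -(osub_sub_ge0 x 0) sub0r.
case: ifP => h1; case: ifP => h2 //.
  by rewrite (osub_le0_anti h2 h1) oppr0.
by have := osub_le0_total x; rewrite h1 h2.
Qed.

Lemma osub_ge0_norm x : osub_le 0 x -> osub_norm x = x.
Proof. by rewrite /osub_norm => ->. Qed.

HB.instance Definition _ := Num.IntegralDomain_isLeReal.Build M
  osub_le0_add osub_le0_mul osub_le0_anti osub_sub_ge0 osub_le0_total
  osub_normN osub_ge0_norm (fun _ _ => erefl).

Definition osub_val (x : M) : Omega := val x.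
HB.instance Definition _ := GRing.RMorphism.copy osub_val (val : M -> Omega).

Lemma osub_ge0 (x : M) : reflect (T (osub_val x)) (0 <= x).
Proof. by rewrite [0 <= x]osub_le0; apply: asboolP. Qed.

Lemma osub_valP x : span_sub T x -> exists c : M, x = osub_val c.
Proof. by move=> /span_predP Sx; exists (Sub x Sx). Qed.

End MaxPreorderingField.

(** * Maximal ordered subfields of an algebraically closed field are real closed *)

Section SumsOfSquaresPoly.
Variable M : realFieldType.

Definition wsos (s : seq (M * {poly M})) : {poly M} := \sum_(t <- s) t.1 *: t.2 ^+ 2.

Definition nneg_weights (s : seq (M * {poly M})) : bool := all (fun t => 0 <= t.1) s.

Lemma wsos_ge0 s x : nneg_weights s -> 0 <= (wsos s).[x].
Proof.
rewrite /wsos; elim: s => [|[t g] s IHs] /=; first by rewrite big_nil horner0.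
move=> /andP[t0 /IHs s0]; rewrite big_cons hornerD hornerZ horner_exp.
by rewrite addr_ge0 // mulr_ge0 // sqr_ge0.
Qed.

(* Reducing the g_i modulo p, the cofactor of p in 1 + sum t_i g_i^2 has
   smaller degree and also changes sign between a and b. *)
Lemma sign_change_ndvd_wsos (a b : M) (p : {poly M}) s :
  p.[a] * p.[b] < 0 -> nneg_weights s -> ~~ (p %| 1 + wsos s).
Proof.
have [n] := ubnP (size p); elim: n p s => // n IHn p s pn pab ws.
apply/negP => dvd.
have sp : (1 < size p)%N.
  rewrite ltnNge; apply/negP => /size1_polyC pc.
  by move: pab; rewrite pc !hornerC -expr2 ltNge sqr_ge0.
pose s' := [seq (t.1, t.2 %% p) | t <- s].
have ws' : nneg_weights s' by rewrite /nneg_weights all_map.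
have pos x : 0 < (1 + wsos s').[x].
  by rewrite hornerD hornerC; apply: ltr_pwDl; rewrite ?ltr01 ?wsos_ge0.
have dvd' : p %| 1 + wsos s'.
  have -> : 1 + wsos s' = (1 + wsos s) - (wsos s - wsos s') by ring.
  rewrite dvdp_sub // /wsos big_map -sumrB.
  elim/big_rec: _ => [|t q _ dq]; first exact: dvdp0.
  rewrite dvdp_add // -scalerBr -mul_polyC dvdp_mull // subr_sqr dvdp_mulr //=.
  by rewrite {1}(divp_eq t.2 p) addrK dvdp_mull.
have p0 : p != 0 by rewrite -size_poly_gt0 ltnW.
set Q := 1 + wsos s' in pos dvd'.
have Q0 : Q != 0 by apply/eqP => Q0; have := pos a; rewrite Q0 horner0 ltxx.
have sQ : (size Q <= (size p + size p) - 3)%N.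
  apply: (leq_trans (size_polyD _ _)); rewrite geq_max size_poly1; apply/andP; split.
    by lia.
  rewrite /wsos big_map; apply: (leq_trans (size_sum _ _ _)).
  apply/bigmax_leqP_seq => t _ _; apply: (leq_trans (size_scale_leq _ _)) => /=.
  have := ltn_modp t.2 p; rewrite p0 expr2 => smod.
  apply: (leq_trans (size_polyMleq _ _)). move: smod sp; set u := size _. set v := size p. lia.
have Qh : Q = Q %/ p * p by rewrite divpK.
have sh : (size (Q %/ p)%R < n)%N by rewrite size_divp //; move: sp pn sQ; set u := size p; set v := size Q; lia.
move: (Q %/ p) Qh sh => h Qh sh.
have hab : h.[a] * h.[b] < 0.
  have := mulr_gt0 (pos a) (pos b); rewrite Qh !hornerM mulrACA.
  by rewrite (nmulr_lgt0 _ pab).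
by have := IHn _ s' sh hab ws'; rewrite -/Q Qh dvdp_mulr.
Qed.

End SumsOfSquaresPoly.

Section RealClosure.
Variables (Omega : closedFieldType) (T : set Omega) (maxT : max_preordering T).
Let pT : preordering T := proj1 maxT.
Local Notation M := (ordered_subfield maxT).

Section Root.
Variables (p : {poly M}) (z : Omega) (a b : M).
Hypothesis pab : p.[a] * p.[b] < 0.
Hypothesis irr : forall q r : {poly M}, p = q * r -> (size q = 1)%N \/ (size r = 1)%N.
Let ev : {rmorphism {poly M} -> Omega} := horner_eval z \o map_poly (@osub_val _ _ maxT).
Hypothesis evp : ev p = 0.

Let evC c : ev c%:P = osub_val c.
Proof. by rewrite /ev /= /horner_eval map_polyC hornerC. Qed.

Let ev_eq0 w : ev w = 0 -> p %| w.
Proof.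
move=> w0; have : p = p %/ gcdp p w * gcdp p w by rewrite divpK ?dvdp_gcdl.
case/irr => s1.
  have /size_poly1P [c c0 e] := introT eqP s1.
  have := divpK (dvdp_gcdl p w); rewrite e => <-.
  by rewrite mul_polyC dvdpZl // dvdp_gcdr.
have /Bezout_eq1_coprimepP [[u v] /= e] : coprimep p w by rewrite /coprimep s1.
by have := congr1 ev e; rewrite rmorphD !rmorphM evp w0 !mulr0 addr0 rmorph1
  => /esym/eqP; rewrite oner_eq0.
Qed.

Let T' : set Omega := fun x => exists s, nneg_weights s /\ x = ev (wsos s).

Let nneg_cat (s t : seq (M * {poly M})) : nneg_weights s -> nneg_weights t -> nneg_weights (s ++ t).
Proof. by rewrite /nneg_weights all_cat => -> ->. Qed.

Let T'sqr w : T' (ev w ^+ 2).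
Proof.
exists [:: (1, w)]; split; first by rewrite /nneg_weights /= ler01.
by rewrite /wsos big_seq1 scale1r rmorphXn.
Qed.

Let two_neq0 : (2 : M) != 0. Proof. by rewrite pnatr_eq0. Qed.

Let T'ev w : span_sub T' (ev w).
Proof.
exists (ev (2^-1 *: (w + 1)) ^+ 2), (ev (2^-1 *: (w - 1)) ^+ 2); split => //.
rewrite -!rmorphXn -rmorphB; congr (ev _).
rewrite -!mul_polyC; set h := _%:P.
have hh : h * 2 = 1 by rewrite /h -[2]/(2%:R) -polyC_natr -polyCM mulVf.
transitivity ((h * 2) * (h * 2) * w); first by rewrite hh !mul1r.
by ring.
Qed.

(** The values at [z] of weighted sums of squares form a preordering [T'] of M(z) that contains [T]:
    if -1 were such a value, [p] would divide 1 plus a weighted sum of squares, against its change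
    of sign. By maximality M(z) = M. *)
Lemma real_root_exists : exists c : M, z = osub_val c.
Proof.
have spanT' x : span_sub T' x -> exists w, x = ev w.
  by move=> [_ [_ [[s [_ ->]] [t [_ ->]] ->]]]; exists (wsos s - wsos t); rewrite rmorphB.
have TT' : (T `<=` T')%classic.
  move=> x Tx; have [c e] := osub_valP maxT (span_sub_sup pT Tx).
  rewrite e in Tx *; exists [:: (c, 1)]; split.
    by rewrite /nneg_weights /= andbT; apply/osub_ge0.
  by rewrite /wsos big_seq1 expr1n alg_polyC evC.
have pT' : preordering T'.
  split.
  - by exists [::]; rewrite /wsos big_nil rmorph0.
  - by apply: TT'; apply: preordering1.
  - move=> _ _ [s [ws ->]] [t [wt ->]]; exists (s ++ t); split; first exact: nneg_cat.
    by rewrite /wsos big_cat rmorphD.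
  - move=> _ _ [s [ws ->]] [t [wt ->]].
    exists [seq (x.1 * y.1, x.2 * y.2) | x <- s, y <- t]; split.
      apply/allP => _ /allpairsP [[x y] [/= xs yt ->]] /=.
      by apply: mulr_ge0; [exact: (allP ws _ xs)|exact: (allP wt _ yt)].
    rewrite /wsos big_allpairs_dep -rmorphM; congr (ev _).
    rewrite mulr_suml; apply: eq_bigr => x _; rewrite mulr_sumr.
    by apply: eq_bigr => y _ /=; rewrite exprMn -!mul_polyC polyCM; ring.
  - move=> [s [ws e]]; have := sign_change_ndvd_wsos pab ws.
    by rewrite ev_eq0 // rmorphD rmorph1 -e subrr.
  - by move=> _ /spanT' [w ->].
  - move=> _ /spanT' [w ->].
    have [->|w0] := eqVneq (ev w) 0; first by rewrite invr0 -(rmorph0 ev).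
    have npw : ~~ (p %| w).
      by apply: contraNN w0 => /divpK <-; rewrite rmorphM evp mulr0.
    have /Bezout_eq1_coprimepP [[u v] /= e] : coprimep p w.
      have : p = p %/ gcdp p w * gcdp p w by rewrite divpK ?dvdp_gcdl.
      case/irr => s1; last by rewrite /coprimep s1.
      have /size_poly1P [c c0 ec] := introT eqP s1.
      case/negP: npw; have := divpK (dvdp_gcdl p w); rewrite ec => <-.
      by rewrite mul_polyC dvdpZl // dvdp_gcdr.
    suff -> : (ev w)^-1 = ev v by [].
    apply: (mulIf w0); rewrite mulVf // -rmorphM -(rmorph1 ev) -e rmorphD.
    by rewrite [ev (u * p)]rmorphM evp mulr0 add0r.
have zX : z = ev 'X by rewrite /ev /= /horner_eval map_polyX hornerX.
have T'T := proj2 maxT _ pT' TT'.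
apply: (osub_valP maxT); rewrite zX; have [t [s [T't T's ->]]] := T'ev 'X.
by exists t, s; split => //; apply: T'T.
Qed.

End Root.

(** A sign change of a product is a sign change of one of the factors, so induction reduces to
    irreducible polynomials. Such a polynomial has a root in [Omega], which lies in the subfield;
    hence it is linear, and its root lies between [a] and [b]. *)
Lemma ordered_subfield_ivt : Num.real_closed_axiom M.
Proof.
suff ivt (p : {poly M}) a b : a <= b -> p.[a] * p.[b] <= 0 ->
    exists2 x, a <= x <= b & root p x.
  by move=> p a b ab /andP[pa pb]; apply: ivt => //; rewrite mulr_le0_ge0.
have [n] := ubnP (size p); elim: n p => // n IHn p pn ab.
have [pa0 _|pa0] := eqVneq p.[a] 0; first by exists a; rewrite ?lexx ?ab // /root pa0.
have [pb0 _|pb0] := eqVneq p.[b] 0; first by exists b; rewrite ?lexx ?ab // /root pb0.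
rewrite le_eqVlt mulf_eq0 (negPf pa0) (negPf pb0) /= => pab.
have p0 : p != 0 by apply: contraNneq pa0 => ->; rewrite horner0.
have split q r : p = q * r -> (size q < n)%N -> (size r < n)%N ->
    exists2 x, a <= x <= b & root p x.
  move=> e sq sr; have : (q.[a] * q.[b] <= 0) || (r.[a] * r.[b] <= 0).
    rewrite -[_ || _]negbK negb_or -!ltNge; apply/negP => /andP[q0 r0].
    have := mulr_gt0 q0 r0; rewrite mulrACA -!hornerM -e.
    by rewrite ltNge ltW.
  case/orP => [/(IHn _ sq ab)|/(IHn _ sr ab)] [x xab rx];
    by exists x => //; rewrite e rootM rx ?orbT.
have [irr|] := pselect (forall q r : {poly M}, p = q * r ->
    (size q = 1)%N \/ (size r = 1)%N); last first.
  move=> /existsNP [q /existsNP [r /not_implyP [e /not_orP [/eqP q1 /eqP r1]]]].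
  have [q0 r0] : q != 0 /\ r != 0.
    by move: p0; rewrite e mulf_eq0 negb_or => /andP.
  have := size_mul q0 r0; rewrite -e => sp.
  move: (size_poly_gt0 q) (size_poly_gt0 r); rewrite q0 r0 => sq sr.
  by apply: (split q r e); move: sq sr sp q1 r1 pn;
    set u := size q; set v := size r; set w := size p; lia.
have sp : (1 < size p)%N.
  rewrite ltnNge; apply/negP => /size1_polyC pc.
  by move: pab; rewrite pc !hornerC -expr2 ltNge sqr_ge0.
have /closed_rootP [z rz] : size (map_poly (@osub_val _ _ maxT) p) != 1%N.
  by rewrite size_map_poly; case: (size p) sp => [|[]].
have [c zc] := @real_root_exists p z a b pab irr (rootP rz).
have rc : root p c by move: rz; rewrite zc fmorph_root.
have [q qE] := factor_theorem _ _ rc.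
have sq : (size q = 1)%N.
  have [q1|] := irr _ _ qE; first by [].
  by rewrite size_XsubC.
have [k k0 qk] := size_poly1P q (introT eqP sq).
exists c => //; move: pab; rewrite qE qk !hornerM !hornerC !hornerXsubC.
have -> : k * (a - c) * (k * (b - c)) = k ^+ 2 * ((a - c) * (b - c)) by ring.
rewrite pmulr_rlt0; last by rewrite lt_def sqr_ge0 sqrf_eq0 k0.
move=> neg; apply/andP; split; rewrite leNgt; apply: contraL neg => cab; rewrite -leNgt.
  by rewrite mulr_ge0 // subr_ge0 ltW // (lt_le_trans cab).
by rewrite mulr_le0 // subr_le0 ltW // (le_lt_trans ab).
Qed.

HB.instance Definition _ := Num.RealField_isClosed.Build M ordered_subfield_ivt.
End RealClosure.

(** * Ultrapowers of real closed fields *)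

Section Ultrapower.
Local Open Scope quotient_scope.
Variables (I : Type) (R : rcfType).

Definition ueq (U : set_system I) (f g : I -> R) : bool := `[< U [set i | f i = g i]%classic >].

Lemma ueq_refl (U : set_system I) (UU : UltraFilter U) : reflexive (ueq U).
Proof. by move=> f; apply/asboolP; apply: filterE. Qed.

Lemma ueq_sym (U : set_system I) (UU : UltraFilter U) : ssrbool.symmetric (ueq U).
Proof.
by move=> f g; apply/asboolP/asboolP; apply: filterS => i /= ->.
Qed.

Lemma ueq_trans (U : set_system I) (UU : UltraFilter U) : transitive (ueq U).
Proof.
move=> g f h /asboolP fg /asboolP gh; apply/asboolP.
by apply: filterS2 fg gh => i /= -> ->.
Qed.

Variables (U : set_system I) (UU : UltraFilter U).

Definition ueq_equiv : equiv_rel (I -> R) :=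
  EquivRel (ueq U) (ueq_refl UU) (ueq_sym UU) (ueq_trans UU).

Definition ultrapower : Type := {eq_quot ueq_equiv}.
HB.instance Definition _ := Choice.on ultrapower.
HB.instance Definition _ := EqQuotient.on ultrapower.

Local Notation uR := ultrapower.

Definition ucl (f : I -> R) : uR := \pi_{eq_quot ueq_equiv} f.
Definition urep (x : uR) : I -> R := generic_quotient.repr x.

Lemma urepK x : ucl (urep x) = x. Proof. exact: reprK. Qed.

Lemma ucl_eq f g : ucl f = ucl g <-> U [set i | f i = g i]%classic.
Proof.
split; first by move=> /eqmodP /asboolP.
by move=> Ufg; apply/eqmodP/asboolP.
Qed.

Lemma urep_ucl f : U [set i | urep (ucl f) i = f i]%classic.
Proof. by apply/ucl_eq; rewrite urepK. Qed.

Definition uzero : uR := ucl (fun=> 0).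
Definition uone : uR := ucl (fun=> 1).
Definition uopp (x : uR) : uR := ucl (fun i => - urep x i).
Definition uadd (x y : uR) : uR := ucl (fun i => urep x i + urep y i).
Definition umul (x y : uR) : uR := ucl (fun i => urep x i * urep y i).
Definition uinv (x : uR) : uR := ucl (fun i => (urep x i)^-1).
Definition ule (x y : uR) : bool := `[< U [set i | urep x i <= urep y i]%classic >].
Definition unorm (x : uR) : uR := ucl (fun i => `|urep x i|).

Lemma uoppE f : uopp (ucl f) = ucl (fun i => - f i).
Proof. by apply/ucl_eq; apply: filterS (urep_ucl f) => i /= ->. Qed.
Lemma uaddE f g : uadd (ucl f) (ucl g) = ucl (fun i => f i + g i).
Proof. by apply/ucl_eq; apply: filterS2 (urep_ucl f) (urep_ucl g) => i /= -> ->. Qed.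
Lemma umulE f g : umul (ucl f) (ucl g) = ucl (fun i => f i * g i).
Proof. by apply/ucl_eq; apply: filterS2 (urep_ucl f) (urep_ucl g) => i /= -> ->. Qed.
Lemma uinvE f : uinv (ucl f) = ucl (fun i => (f i)^-1).
Proof. by apply/ucl_eq; apply: filterS (urep_ucl f) => i /= ->. Qed.
Lemma unormE f : unorm (ucl f) = ucl (fun i => `|f i|).
Proof. by apply/ucl_eq; apply: filterS (urep_ucl f) => i /= ->. Qed.
Lemma uleP f g : reflect (U [set i | f i <= g i]%classic) (ule (ucl f) (ucl g)).
Proof.
apply: (iffP (asboolP _)) => fg.
  have fU := urep_ucl f; have gU := urep_ucl g.
  by apply: filterS3 fU gU fg => i /= <- <-.
by apply: filterS3 (urep_ucl f) (urep_ucl g) fg => i /= -> ->.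
Qed.

Lemma ucl_ind (P : uR -> Prop) : (forall f, P (ucl f)) -> forall x, P x.
Proof. by move=> Pf x; rewrite -[x]urepK. Qed.
Lemma ucl_ind2 (P : uR -> uR -> Prop) :
  (forall f g, P (ucl f) (ucl g)) -> forall x y, P x y.
Proof. by move=> Pf x y; rewrite -[x]urepK -[y]urepK. Qed.
Lemma ucl_ind3 (P : uR -> uR -> uR -> Prop) :
  (forall f g h, P (ucl f) (ucl g) (ucl h)) -> forall x y z, P x y z.
Proof. by move=> Pf x y z; rewrite -[x]urepK -[y]urepK -[z]urepK. Qed.

Lemma uaddA : associative uadd.
Proof. by apply: ucl_ind3 => x y z; rewrite !uaddE; apply/ucl_eq/filterE => i /=; rewrite addrA. Qed.
Lemma uaddC : commutative uadd.
Proof. by apply: ucl_ind2 => x y; rewrite !uaddE; apply/ucl_eq/filterE => i /=; rewrite addrC. Qed.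
Lemma uadd0 : left_id uzero uadd.
Proof. by apply: ucl_ind => x; rewrite !uaddE; apply/ucl_eq/filterE => i /=; rewrite add0r. Qed.
Lemma uaddN : left_inverse uzero uopp uadd.
Proof. by apply: ucl_ind => x; rewrite uoppE uaddE; apply/ucl_eq/filterE => i /=; rewrite addNr. Qed.

HB.instance Definition _ := GRing.isZmodule.Build uR uaddA uaddC uadd0 uaddN.

Lemma umulA : associative umul.
Proof. by apply: ucl_ind3 => x y z; rewrite !umulE; apply/ucl_eq/filterE => i /=; rewrite mulrA. Qed.
Lemma umulC : commutative umul.
Proof. by apply: ucl_ind2 => x y; rewrite !umulE; apply/ucl_eq/filterE => i /=; rewrite mulrC. Qed.
Lemma umul1 : left_id uone umul.
Proof. by apply: ucl_ind => x; rewrite !umulE; apply/ucl_eq/filterE => i /=; rewrite mul1r. Qed.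
Lemma umulD : left_distributive umul uadd.
Proof.
by apply: ucl_ind3 => x y z; rewrite [uadd (ucl x) _]uaddE !umulE uaddE; apply/ucl_eq/filterE => i /=; rewrite mulrDl.
Qed.
Lemma uone_neq0 : uone != uzero.
Proof.
apply/eqP => /ucl_eq U0; have [i /= /eqP] := filter_ex U0.
by rewrite oner_eq0.
Qed.

HB.instance Definition _ := GRing.Zmodule_isComNzRing.Build uR
  umulA umulC umul1 umulD uone_neq0.

Lemma umulV : forall x : uR, x != 0 -> uinv x * x = 1.
Proof.
apply: ucl_ind => x x0; rewrite uinvE; rewrite [LHS]umulE; apply/ucl_eq.
have [|nx] := in_ultra_setVsetC [set i | x i = 0]%classic UU.
  by move=> /(ucl_eq _ (fun=> 0)) e; rewrite e eqxx in x0.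
by apply: filterS nx => i /= /eqP xi; rewrite mulVf.
Qed.
Lemma uinv0 : uinv 0 = 0 :> uR.
Proof. by rewrite [LHS]uinvE; apply/ucl_eq/filterE => i /=; rewrite invr0. Qed.

HB.instance Definition _ := GRing.ComNzRing_isField.Build uR umulV uinv0.

Lemma ule0_add x y : ule 0 x -> ule 0 y -> ule 0 (x + y).
Proof.
move: x y; apply: ucl_ind2 => x y /uleP x0 /uleP y0; rewrite [_ + _]uaddE; apply/uleP.
by apply: filterS2 x0 y0 => i /=; apply: addr_ge0.
Qed.
Lemma ule0_mul x y : ule 0 x -> ule 0 y -> ule 0 (x * y).
Proof.
move: x y; apply: ucl_ind2 => x y /uleP x0 /uleP y0; rewrite [_ * _]umulE; apply/uleP.
by apply: filterS2 x0 y0 => i /=; apply: mulr_ge0.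
Qed.
Lemma ule0_anti x : ule 0 x -> ule x 0 -> x = 0.
Proof.
move: x; apply: ucl_ind => x /uleP x0 /uleP y0; apply/ucl_eq.
by apply: filterS2 x0 y0 => i /= xi yi; apply/le_anti; rewrite xi yi.
Qed.
Lemma usub_ge0 x y : ule 0 (y - x) = ule x y.
Proof.
move: x y; apply: ucl_ind2 => x y; rewrite [- _]uoppE [_ + _]uaddE.
by apply/uleP/uleP; apply: filterS => i /=; rewrite subr_ge0.
Qed.
Lemma ule0_total x : ule 0 x || ule x 0.
Proof.
move: x; apply: ucl_ind => x; have [x0|x0] := in_ultra_setVsetC [set i | 0 <= x i]%classic UU.
  by apply/orP; left; apply/uleP.
apply/orP; right; apply/uleP; apply: filterS x0 => i /= /negP.
by rewrite -ltNge => /ltW.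
Qed.
Lemma unormN x : unorm (- x) = unorm x.
Proof.
move: x; apply: ucl_ind => x; rewrite [- _]uoppE !unormE.
by apply/ucl_eq/filterE => i /=; rewrite normrN.
Qed.
Lemma uge0_norm x : ule 0 x -> unorm x = x.
Proof.
move: x; apply: ucl_ind => x /uleP x0; rewrite unormE; apply/ucl_eq.
by apply: filterS x0 => i /= /ger0_norm.
Qed.

HB.instance Definition _ := Num.IntegralDomain_isLeReal.Build uR
  ule0_add ule0_mul ule0_anti usub_ge0 ule0_total unormN uge0_norm (fun _ _ => erefl).

Lemma ucl_le f g : reflect (U [set i | f i <= g i]%classic) (ucl f <= ucl g).
Proof. exact: uleP. Qed.

Lemma ucl_sum n (F : 'I_n -> I -> R) : ucl (fun i => \sum_k F k i) = \sum_k ucl (F k).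
Proof.
elim: n F => [|n IHn] F.
  by rewrite big_ord0; apply/ucl_eq/filterE => i /=; rewrite big_ord0.
rewrite big_ord_recl -IHn [RHS]uaddE; apply/ucl_eq/filterE => i /=.
by rewrite big_ord_recl.
Qed.

Lemma ucl_exp f n : ucl f ^+ n = ucl (fun i => f i ^+ n).
Proof.
elim: n => [|n IHn]; first by rewrite expr0; apply/ucl_eq/filterE => i /=; rewrite expr0.
by rewrite exprS IHn [LHS]umulE; apply/ucl_eq/filterE => i /=; rewrite exprS.
Qed.

(** A polynomial over the ultrapower as a family of polynomials over [R] of uniformly bounded
    size. *)
Definition upoly (p : {poly uR}) (i : I) : {poly R} := \poly_(k < size p) urep p`_k i.

Lemma ucl_horner (p : {poly uR}) f : p.[ucl f] = ucl (fun i => (upoly p i).[f i]).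
Proof.
transitivity (\sum_(k < size p) ucl (fun i => urep p`_k i * f i ^+ k)).
  rewrite horner_coef; apply: eq_bigr => k _.
  by rewrite ucl_exp -[in LHS](urepK p`_k) [LHS]umulE.
rewrite -ucl_sum; apply/ucl_eq/filterE => i /=.
by rewrite horner_poly.
Qed.

Lemma ultrapower_ivt : Num.real_closed_axiom uR.
Proof.
move=> p a b; rewrite -[a]urepK -[b]urepK; move: (urep a) (urep b) => {}a {}b.
rewrite !ucl_horner => /ucl_le ab /andP[/ucl_le pa /ucl_le pb].
(* Roots are chosen at the indices where the hypotheses hold; at the others, a set that [U]
   neglects, the value is 0. *)
have /choice [c cP] i : exists c, a i <= b i -> (upoly p i).[a i] <= 0 ->
    0 <= (upoly p i).[b i] -> a i <= c <= b i /\ (upoly p i).[c] = 0.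
  have [abi|] := boolP (a i <= b i); last by exists 0.
  have [pai|] := boolP ((upoly p i).[a i] <= 0); last by exists 0.
  have [pbi|] := boolP (0 <= (upoly p i).[b i]); last by exists 0.
  have [|c cab /rootP rc] := @poly_ivt _ (upoly p i) _ _ abi; first by rewrite pai.
  by exists c.
exists (ucl c).
  apply/andP; split; apply/ucl_le; apply: filterS3 ab pa pb => i /= abi pai pbi;
    by have [/andP[]] := cP i abi pai pbi.
apply/rootP; rewrite ucl_horner; apply/ucl_eq.
by apply: filterS3 ab pa pb => i /= abi pai pbi; have [] := cP i abi pai pbi.
Qed.

HB.instance Definition _ := Num.RealField_isClosed.Build uR ultrapower_ivt.

End Ultrapower.

(** * Negative values of polynomials and Tarski queries *)

Section NegativeValues.
Variable R : rcfType.
Implicit Types f : {poly R}.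

Lemma negative_right_root f x b : x < b -> f.[x] < 0 -> 0 < f.[b] ->
  exists2 v, x < v & f.[v] = 0 /\ forall y, x <= y < v -> f.[y] < 0.
Proof.
move=> xb fx fb.
have nrx y : (forall z, z \in `]x, y[ -> ~~ root f z) -> forall z, x <= z < y -> f.[z] < 0.
  move=> nr z /andP[]; rewrite le_eqVlt => /orP[/eqP <- //|xz zy].
  rewrite ltNge; apply/negP => fz.
  have [|w /andP[xw wz] rw] := @poly_ivt _ f x z (ltW xz); first by rewrite fz ltW.
  have [ew|nx] := eqVneq w x; first by move: rw; rewrite ew /root lt_eqF.
  have := nr w; rewrite in_itv /= rw (le_lt_trans wz zy) lt_neqAle eq_sym nx xw.
  by move=> /(_ isT).
have f0 : f != 0 by apply: contraTneq fx => ->; rewrite horner0 ltxx.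
case: (next_rootP f x b) => [e|y _ fy0 yxb nr|c _ ce nr].
- by rewrite e eqxx in f0.
- exists y; first by rewrite (itvP yxb).
  by split => //; apply: nrx.
- have [//|w] := @poly_ivtoo _ f x b (ltW xb); first by rewrite nmulr_rlt0.
  by move=> /nr /negP.
Qed.

Lemma negative_left_root f x a : a < x -> f.[x] < 0 -> 0 < f.[a] ->
  exists2 u, u < x & f.[u] = 0 /\ forall y, u < y <= x -> f.[y] < 0.
Proof.
move=> ax fx fa.
have [|||v xv [fv neg]] := @negative_right_root (f \Po (- 'X)) (- x) (- a).
- by rewrite ltrN2.
- by rewrite horner_comp hornerN hornerX opprK.
- by rewrite horner_comp hornerN hornerX opprK.
exists (- v); first by rewrite ltrNl.
move: fv; rewrite horner_comp hornerN hornerX => fv; split => // y /andP[vy yx].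
have := neg (- y); rewrite horner_comp hornerN hornerX opprK; apply.
by rewrite lerN2 yx ltrNl.
Qed.

(** As [f] is positive near both ends, [x] lies between two roots [u] and [v] with [f] negative in
    between; Rolle's theorem applies to them. *)
Lemma negative_value_critical f x : f.[x] < 0 -> sgp_pinfty f = 1 -> sgp_minfty f = 1 ->
  exists2 c, c \in rootsR f^`() & f.[c] < 0.
Proof.
move=> fx pinf minf.
have f0 : f != 0 by apply: contraTneq fx => ->; rewrite horner0 ltxx.
have pos_right : exists2 b, x < b & 0 < f.[b].
  exists (Num.max (x + 1) (cauchy_bound f)); first by rewrite lt_max ltrDl ltr01.
  rewrite -sgr_cp0 (sgp_pinftyP (ge_cauchy_bound f0)) ?pinf //.
  by rewrite in_itv /= andbT le_max lexx orbT.
have pos_left : exists2 a, a < x & 0 < f.[a].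
  exists (Num.min (x - 1) (- cauchy_bound f)); first by rewrite gt_min ltrBlDr ltrDl ltr01.
  rewrite -sgr_cp0 (sgp_minftyP (le_cauchy_bound f0)) ?minf //.
  by rewrite in_itv /= ge_min lexx orbT.
have [b xb fb] := pos_right; have [a ax fa] := pos_left.
have [v xv [fv negv]] := negative_right_root xb fx fb.
have [u ux [fu negu]] := negative_left_root ax fx fa.
have [|c cuv fc] := @poly_rolle _ u v f (lt_trans ux xv); first by rewrite fu fv.
have negc : f.[c] < 0.
  have [cx|xc] := leP c x; first by rewrite negu // cx (itvP cuv).
  by rewrite negv // (ltW xc) (itvP cuv).
exists c => //.
have f'0 : f^`() != 0.
  apply: contraTneq fx => e; have := @poly_mvt _ x v f xv.
  by case=> w _; rewrite e horner0 mul0r fv sub0r => /eqP; rewrite oppr_eq0 => /eqP ->; rewrite ltxx.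
by rewrite -(roots_on_rootsR f'0) /root fc eqxx.
Qed.

Lemma sgp_pinfty_neg f : sgp_pinfty f = -1 -> exists x, f.[x] < 0.
Proof.
move=> pinf; have f0 : f != 0.
  by apply: contra_eqN pinf => /eqP ->; rewrite /sgp_pinfty lead_coef0 sgr0 eq_sym oppr_eq0 oner_eq0.
exists (cauchy_bound f); rewrite -sgr_cp0 (sgp_pinftyP (ge_cauchy_bound f0)) ?pinf //.
by rewrite in_itv /= lexx.
Qed.

Lemma sgp_minfty_neg f : sgp_minfty f = -1 -> exists x, f.[x] < 0.
Proof.
rewrite -sgp_pinfty_sym => /sgp_pinfty_neg [x].
by rewrite horner_comp => fx; eexists; exact: fx.
Qed.

(** The difference of the two queries is a sum of terms sgn f(c)^2 - sgn f(c), each equal to 2 if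
    f(c) < 0 and to 0 otherwise. *)
Lemma taq_negative f (z : seq R) :
  (exists2 c, c \in z & f.[c] < 0) <-> taq z (f ^+ 2) != taq z f.
Proof.
have -> : taq z (f ^+ 2) != taq z f = has (fun c => f.[c] < 0) z; last first.
  by split => [[c cz fc]|/hasP [c]]; [apply/hasP|]; exists c.
have ge c : sgz f.[c] <= sgz (f ^+ 2).[c] ?= iff ~~ (f.[c] < 0).
  rewrite horner_exp sgzX; split; last by case: sgzP.
  by case: sgzP.
rewrite /taq eq_sym.
have [_ ->] : \sum_(c <- z) sgz f.[c] <= \sum_(c <- z) sgz (f ^+ 2).[c]
    ?= iff all (fun c => ~~ (f.[c] < 0)) z.
  elim: (z) => [|c s IHs]; first by rewrite !big_nil; apply/leif_refl.
  by rewrite !big_cons; apply: leifD (ge c) IHs.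
by rewrite -has_predC; apply: eq_has => c /=; rewrite negbK.
Qed.

(** Negative values are detected at the two ends or at a critical point. The right-hand side depends
    only on signs of expressions in the coefficients, which makes it transferable. *)
Lemma negative_valueP f :
  (exists x, f.[x] < 0) <->
  [|| sgp_pinfty f == -1, sgp_minfty f == -1
    | (f != 0) && (taqR f^`() (f ^+ 2) != taqR f^`() f)].
Proof.
rewrite -!taq_taqR; split; last first.
  case/or3P => [/eqP/sgp_pinfty_neg|/eqP/sgp_minfty_neg|] //.
  by move=> /andP[_ /taq_negative [c _ fc]]; exists c.
move=> [x fx]; have f0 : f != 0 by apply: contraTneq fx => ->; rewrite horner0 ltxx.
have l0 : lead_coef f != 0 by rewrite lead_coef_eq0.
rewrite f0 /=; have [//|npinf] := eqVneq (sgp_pinfty f) (-1).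
have [//|nminf] := eqVneq (sgp_minfty f) (-1).
have sg1 (y : R) : y != 0 -> Num.sg y != -1 -> Num.sg y = 1 by case: sgrP => // _ _ /eqP.
apply/taq_negative; apply: negative_value_critical fx _ _; apply: sg1 => //.
by rewrite mulf_neq0 // signr_eq0.
Qed.

End NegativeValues.

(** * Transfer between two real closed fields *)

Section Transfer.
Variables (k : fieldType) (R1 R2 : rcfType).
Variables (i1 : {rmorphism k -> R1}) (i2 : {rmorphism k -> R2}).
Hypothesis same_sign : forall a, (i1 a < 0) = (i2 a < 0).

Lemma changes_map (s : seq k) : changes (map i1 s) = changes (map i2 s).
Proof.
elim: s => //= a s ->; congr (nat_of_bool _ + _)%N.
by case: s => [|b s] /=; rewrite ?mulr0 ?ltxx // -!rmorphM same_sign.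
Qed.

(** The step of signed remainder sequences over [k] itself: the sequences over [R1] and [R2] are
    images of one sequence over [k]. *)
Definition field_next_mod (p q : {poly k}) :=
  - (lead_coef q ^+ Pdiv.Ring.rscalp p q) *: Pdiv.Ring.rmodp p q.

Lemma next_mod_map (R : rcfType) (i : {rmorphism k -> R}) p q :
  next_mod (map_poly i p) (map_poly i q) = map_poly i (field_next_mod p q).
Proof.
rewrite /next_mod /field_next_mod map_polyZ rmorphN rmorphXn lead_coef_map.
by rewrite /Pdiv.Ring.rscalp /Pdiv.Ring.rmodp redivp_map.
Qed.

Lemma mods_map p q : exists s : seq {poly k},
  mods (map_poly i1 p) (map_poly i1 q) = map (map_poly i1) s /\
  mods (map_poly i2 p) (map_poly i2 q) = map (map_poly i2) s.
Proof.
move e: (mods (map_poly i1 p) (map_poly i1 q)) => l.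
elim: l p q e => [|r l IHl] p q.
  move/eqP; rewrite mods_eq0 map_poly_eq0 => /eqP ->; exists [::].
  by rewrite map_poly0 mods0p.
rewrite mods_rec (mods_rec (map_poly i2 p)) !map_poly_eq0.
case: ifP => // _ [<-]; rewrite !next_mod_map => /IHl [s [-> ->]].
by exists (p :: s).
Qed.

Lemma taqR_map p q :
  taqR (map_poly i1 p) (map_poly i1 q) = taqR (map_poly i2 p) (map_poly i2 q).
Proof.
rewrite /taqR !deriv_map -!rmorphM /changes_mods.
have [s [-> ->]] := mods_map p (p^`() * q).
rewrite /changes_poly /changes_minfty /changes_pinfty -!map_comp.
pose m (r : {poly k}) := (-1) ^+ (~~ odd (size r)) * lead_coef r.
have mE (R : rcfType) (i : {rmorphism k -> R}) :
    [seq (-1) ^+ (~~ odd (size (map_poly i r))) * lead_coef (map_poly i r) | r <- s]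
    = map i (map m s).
  rewrite -map_comp; apply: eq_map => r /=.
  by rewrite size_map_poly lead_coef_map /m rmorphM rmorphXn rmorphN1.
have lE (R : rcfType) (i : {rmorphism k -> R}) :
    [seq lead_coef (map_poly i r) | r <- s] = map i (map lead_coef s).
  by rewrite -map_comp; apply: eq_map => r /=; rewrite lead_coef_map.
congr (_%:Z - _%:Z).
  by have := changes_map (map m s); rewrite -!mE.
by have := changes_map (map lead_coef s); rewrite -!lE.
Qed.

Theorem negative_value_transfer f :
  (exists y, (map_poly i2 f).[y] < 0) -> exists x, (map_poly i1 f).[x] < 0.
Proof.
move/negative_valueP => neg; apply/negative_valueP; move: neg.
rewrite !map_poly_eq0 -!rmorphXn !deriv_map !taqR_map.
rewrite /sgp_pinfty /sgp_minfty !sgr_cp0 !size_map_poly !lead_coef_map.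
have sE (R : rcfType) (i : {rmorphism k -> R}) b a :
    (-1) ^+ b * i a = i ((-1) ^+ b * a).
  by rewrite rmorphM rmorphXn rmorphN1.
by rewrite !(sE _ i1) !(sE _ i2) !same_sign.
Qed.

End Transfer.

(** * Sums of squares in R(X, Y) *)

Lemma subf_div (K : fieldType) (a b c d : K) : b != 0 -> d != 0 ->
  a / b - c / d = (a * d - c * b) / (b * d).
Proof. by move=> b0 d0; rewrite -mulNr addf_div // mulNr. Qed.

Section FractionMorphism.
Variables (A : idomainType) (K : fieldType) (j : {rmorphism A -> K}).
Hypothesis inj_j : forall a, j a = 0 -> a = 0.
Local Notation tofrac := (@FracField.tofrac A).

Lemma fraction_pair (f : {fraction A}) :
  exists ab : A * A, ab.2 != 0 /\ f = tofrac ab.1 / tofrac ab.2.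
Proof. by have [a [b e]] := fraction_quotient f; exists (a, b). Qed.

(** Injectivity of [j] is an argument so that the morphism structure can be attached to the
    function. *)
Definition frac_lift & (forall a, j a = 0 -> a = 0) := fun f : {fraction A} =>
  let ab := projT1 (cid (fraction_pair f)) in j ab.1 / j ab.2.

Local Notation psi := (frac_lift inj_j).

Lemma frac_liftE a b : b != 0 -> psi (tofrac a / tofrac b) = j a / j b.
Proof.
move=> b0; rewrite /frac_lift; case: cid => -[c d] /= [d0 e].
have tb : tofrac b != 0 by rewrite tofrac_eq0.
have td : tofrac d != 0 by rewrite tofrac_eq0.
have : a * d = c * b.
  by apply/eqP; rewrite -tofrac_eq !tofracM -eqr_div // e.
move=> /(congr1 j); rewrite !rmorphM => e'.
have jb : j b != 0 by apply: contraNneq b0 => /inj_j ->.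
have jd : j d != 0 by apply: contraNneq d0 => /inj_j ->.
by apply: (mulIf jb); rewrite divfK //; apply: (mulIf jd); rewrite e' mulrAC divfK.
Qed.

Lemma frac_lift_tofrac a : psi (tofrac a) = j a.
Proof. by rewrite -[tofrac a]divr1 -tofrac1 frac_liftE ?oner_eq0 // rmorph1 divr1. Qed.

Lemma frac_lift_zmod : zmod_morphism psi.
Proof.
move=> f g; have [a [b [b0 ->]]] := fraction_quotient f.
have [c [d [d0 ->]]] := fraction_quotient g.
have tb : tofrac b != 0 by rewrite tofrac_eq0.
have td : tofrac d != 0 by rewrite tofrac_eq0.
have jb : j b != 0 by apply: contraNneq b0 => /inj_j ->.
have jd : j d != 0 by apply: contraNneq d0 => /inj_j ->.
have -> : tofrac a / tofrac b - tofrac c / tofrac d =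
    tofrac (a * d - c * b) / tofrac (b * d).
  by rewrite subf_div // -!tofracM -tofracB.
by rewrite !frac_liftE ?mulf_neq0 // subf_div // rmorphB !rmorphM.
Qed.

Lemma frac_lift_monoid : monoid_morphism psi.
Proof.
split; first by rewrite -tofrac1 frac_lift_tofrac rmorph1.
move=> f g; have [a [b [b0 ->]]] := fraction_quotient f.
have [c [d [d0 ->]]] := fraction_quotient g.
by rewrite mulf_div -!tofracM !frac_liftE ?mulf_neq0 // !rmorphM mulf_div.
Qed.

HB.instance Definition _ := GRing.isZmodMorphism.Build {fraction A} K psi frac_lift_zmod.
HB.instance Definition _ := GRing.isMonoidMorphism.Build {fraction A} K psi frac_lift_monoid.

End FractionMorphism.

Lemma poly_rmorphism_ext (A S : nzRingType) (f g : {rmorphism {poly A} -> S}) :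
  (forall a, f a%:P = g a%:P) -> f 'X = g 'X -> f =1 g.
Proof.
move=> fgC fgX p; rewrite -[p]coefK poly_def !rmorph_sum; apply: eq_bigr => i _.
by rewrite -mul_polyC !rmorphM !rmorphXn fgC fgX.
Qed.

Section SumsOfSquares.
Variable F : fieldType.

Definition is_sos (u : F) := exists s : seq F, u = \sum_(x <- s) x ^+ 2.

Lemma sos_sqr x : is_sos (x ^+ 2). Proof. by exists [:: x]; rewrite big_seq1. Qed.

Lemma sosD u v : is_sos u -> is_sos v -> is_sos (u + v).
Proof. by move=> [s ->] [t ->]; exists (s ++ t); rewrite big_cat. Qed.

Lemma sosM u v : is_sos u -> is_sos v -> is_sos (u * v).
Proof.
move=> [s ->] [t ->]; exists [seq x * y | x <- s, y <- t].
rewrite big_allpairs_dep mulr_suml; apply: eq_bigr => x _.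
by rewrite mulr_sumr; apply: eq_bigr => y _; rewrite exprMn.
Qed.

Lemma sos1 : is_sos 1. Proof. by rewrite -(expr1n _ 2); apply: sos_sqr. Qed.
Lemma sos0 : is_sos 0. Proof. by rewrite -[0](expr0n _ 2); apply: sos_sqr. Qed.

Hypothesis two_neq0 : (2 : F) != 0.

Lemma difference_of_squares (a : F) :
  a = ((a + 1) / 2) ^+ 2 - ((a - 1) / 2) ^+ 2.
Proof. by field. Qed.

(** The elements u - c v, with [u] and [v] sums of squares, form a preordering. Indeed, if -1 = u -
    c v, then c = (1 + u) v (v^-1)^2 is a sum of squares; or v = 0, so -1 is a sum of squares and so
    is every difference of squares, [c] included. As every element is a difference of squares, a
    maximal extension is total. *)
Lemma sos_or_ordered (c : F) : ~ is_sos c ->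
  exists T, [/\ max_preordering T, T (- c) & forall a, T a \/ T (- a)].
Proof.
move=> nc; pose T0 : set F := fun x => exists u v, [/\ is_sos u, is_sos v & x = u - c * v].
have T0sqr a : T0 (a ^+ 2).
  by exists (a ^+ 2), 0; rewrite mulr0 subr0; split => //; [exact: sos_sqr|exact: sos0].
have spanT0 a : span_sub T0 a.
  by exists (((a + 1) / 2) ^+ 2), (((a - 1) / 2) ^+ 2); split => //;
     exact: difference_of_squares.
have pT0 : preordering T0.
  split => //.
  - by rewrite -[0](expr0n _ 2).
  - by rewrite -(expr1n _ 2).
  - move=> _ _ [u [v [su sv ->]]] [u' [v' [su' sv' ->]]].
    by exists (u + u'), (v + v'); split; [exact: sosD|exact: sosD|ring].
  - move=> _ _ [u [v [su sv ->]]] [u' [v' [su' sv' ->]]].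
    exists (u * u' + c ^+ 2 * (v * v')), (u * v' + v * u'); split; last by ring.
      apply: sosD; first exact: sosM.
      by apply: sosM; [exact: sos_sqr|exact: sosM].
    by apply: sosD; apply: sosM.
  - move=> [u [v [su sv e]]]; apply: nc.
    have [v0|v0] := eqVneq v 0.
      rewrite (difference_of_squares c); apply: sosD; first exact: sos_sqr.
      rewrite -[X in is_sos X]mulN1r; apply: sosM; last exact: sos_sqr.
      by rewrite e v0 mulr0 subr0.
    have -> : c = (1 + u) * v * (v^-1) ^+ 2.
      have -> : u = c * v - 1 by rewrite e; ring.
      by field.
    apply: sosM; last exact: sos_sqr.
    by apply: sosM => //; apply: sosD => //; exact: sos1.
have [T maxT T0T] := max_preordering_exists pT0.
exists T; split => //.
  by apply: T0T; exists 0, 1; rewrite mulr1 sub0r; split => //; [exact: sos0|exact: sos1].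
move=> a; apply: max_preordering_total => //.
have [t [s [Tt Ts ->]]] := spanT0 a.
by exists t, s; split => //; apply: T0T.
Qed.

End SumsOfSquares.

(** * Orderings of R(X) and points of [R] *)

Lemma point_in_cut (R : realFieldType) (D : R -> Prop) (S : seq R) :
  (forall r r', D r -> ~ D r' -> r < r') ->
  exists x, forall r, r \in S -> x != r /\ (r < x <-> D r).
Proof.
move=> cut; pose A := [seq r <- S | `[< D r >]]; pose B := [seq r <- S | ~~ `[< D r >]].
have minP (s : seq R) (m : R) : let l := foldr Num.min m s in
    [/\ l <= m, forall r, r \in s -> l <= r & l = m \/ l \in s].
  elim: s => [|r s [lm ls e]] /=; first by split => //; left.
  set l := foldr _ _ _ in lm ls e *; rewrite ge_min lm orbT; split => //.
    by move=> y; rewrite inE => /orP[/eqP ->|/ls ly]; rewrite ge_min ?lexx // ly orbT.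
  case: (leP r l) => _; first by right; rewrite inE eqxx.
  by case: e => [->|e]; [left|right; rewrite inE e orbT].
have maxP (s : seq R) (m : R) : let l := foldr Num.max m s in
    [/\ m <= l, forall r, r \in s -> r <= l & l = m \/ l \in s].
  elim: s => [|r s [lm ls e]] /=; first by split => //; left.
  set l := foldr _ _ _ in lm ls e *; rewrite le_max lm orbT; split => //.
    by move=> y; rewrite inE => /orP[/eqP ->|/ls ly]; rewrite le_max ?lexx // ly orbT.
  case: (leP r l) => _; last by right; rewrite inE eqxx.
  by case: e => [->|e]; [left|right; rewrite inE e orbT].
(* [lo0] is below all of [B] and serves as [lo] when [A] is empty; [lo + 1] serves as [hi] when [B]
   is empty. *)
pose lo0 := foldr Num.min 0 B - 1.
pose lo := foldr Num.max lo0 A; pose hi := foldr Num.min (lo + 1) B.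
have [_ loA loE] := maxP A lo0; have [hi1 hiB hiE] := minP B (lo + 1).
rewrite -/lo in loA loE; rewrite -/hi in hi1 hiB hiE.
have loB r : r \in B -> lo < r.
  move=> rB; case: loE => [->|].
    have [_ /(_ r rB) h _] := minP B 0; rewrite /lo0 ltrBlDr.
    by apply: (le_lt_trans h); rewrite ltrDl ltr01.
  rewrite mem_filter => /andP[/asboolP Dlo _]; apply: cut => //.
  by move: rB; rewrite mem_filter => /andP[/asboolP].
have lohi : lo < hi by case: hiE => [->|/loB //]; rewrite ltrDl ltr01.
pose x := (lo + hi) / 2.
have lox : lo < x by rewrite midf_lt.
have xhi : x < hi by rewrite midf_lt.
exists x => r rS; have [Dr|nDr] := pselect (D r).
  have rx : r < x.
    apply: le_lt_trans lox; apply: loA; rewrite mem_filter rS andbT; exact/asboolP.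
  by split; [rewrite gt_eqF|split].
have xr : x < r.
  apply: (lt_le_trans xhi); apply: hiB; rewrite mem_filter rS andbT; exact/asboolP.
by split; [rewrite lt_eqF|split => // /(lt_trans xr); rewrite ltxx].
Qed.

Section OrderedFunctionField.
Variables (R : rcfType) (F : fieldType) (E : {rmorphism {poly R} -> F}).
Hypothesis E_inj : forall h, E h = 0 -> h = 0.
Variable T : set F.
Hypothesis maxT : max_preordering T.
Hypothesis totT : forall a, T a \/ T (- a).
Let pT : preordering T := proj1 maxT.

Lemma total_span a : span_sub T a.
Proof.
have [Ta|TNa] := totT a; first exact: span_sub_sup.
by exists 0, (- a); rewrite sub0r opprK; split => //; exact: (preordering0 pT).
Qed.

Lemma total_sqr a : T (a ^+ 2). Proof. exact/(preordering_sqr pT)/total_span. Qed.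

Lemma total_mulP a b : a != 0 -> b != 0 -> T (a * b) <-> (T a <-> T b).
Proof.
move=> a0 b0; have ab0 : a * b != 0 by rewrite mulf_neq0.
have anti x : x != 0 -> T x -> T (- x) -> False.
  by move=> x0 Tx TNx; case/eqP: x0; apply: (preordering_anti pT).
have M := preorderingM pT.
have [Ta|TNa] := totT a; have [Tb|TNb] := totT b.
- by split => // _; apply: M.
- split; last by case => /(_ Ta) Tb; case: (anti b).
  by move=> Tab; case: (anti _ ab0 Tab); rewrite -mulrN; apply: M.
- split; last by case => _ /(_ Tb) Ta; case: (anti a).
  by move=> Tab; case: (anti _ ab0 Tab); rewrite -mulNr; apply: M.
- split; last by move=> _; rewrite -mulrNN; apply: M.
  by move=> _; split => [Ta|Tb]; [case: (anti a)|case: (anti b)].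
Qed.

(** The ordering is seen from [R] through the cut of all r below X; [x] imitates X with respect to
    the finite set [S]. *)
Definition in_cut (S : seq R) (x : R) :=
  forall r, r \in S -> x != r /\ (r < x <-> T (E ('X - r%:P))).

Definition same_sign_near (h : {poly R}) :=
  exists S, forall x, in_cut S x -> h.[x] != 0 /\ (0 < h.[x] <-> T (E h)).

Lemma same_sign_mul h h' : h != 0 -> h' != 0 ->
  same_sign_near h -> same_sign_near h' -> same_sign_near (h * h').
Proof.
move=> h0 h'0 [S hS] [S' hS']; exists (S ++ S') => x cx.
have [hx0 hx] : h.[x] != 0 /\ (0 < h.[x] <-> T (E h)).
  by apply: hS => r rS; apply: cx; rewrite mem_cat rS.
have [hx0' hx'] : h'.[x] != 0 /\ (0 < h'.[x] <-> T (E h')).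
  by apply: hS' => r rS; apply: cx; rewrite mem_cat rS orbT.
rewrite hornerM mulf_neq0 //; split => //.
have E0 g : g != 0 -> E g != 0 by apply: contraNneq => /E_inj ->.
rewrite rmorphM total_mulP ?E0 //.
have -> : 0 < h.[x] * h'.[x] <-> (0 < h.[x] <-> 0 < h'.[x]).
  have nf : ~ false by []; have t : true by [].
  have [hneg|hpos|/eqP] := ltrgtP h.[x] 0; last by rewrite (negPf hx0).
    rewrite nmulr_rgt0 //.
    by have [k|k|/eqP] := ltrgtP h'.[x] 0; rewrite ?(negPf hx0') //; tauto.
  rewrite pmulr_rgt0 //.
  by have [k|k|/eqP] := ltrgtP h'.[x] 0; rewrite ?(negPf hx0') //; tauto.
by tauto.
Qed.

(** Signs are multiplicative, so [h] may be split into factors: nonnegative constants are squares, X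
    - a is settled by the cut, and (X - a)^2 + b^2 is positive both at every point and in [T]. A
    complex root a + i b tells which factor to remove. *)
Lemma same_sign_poly h : h != 0 -> same_sign_near h.
Proof.
have [n] := ubnP (size h); elim: n h => // n IHn h hn h0.
have [sh|sh] := leqP (size h) 1.
  have hc := size1_polyC sh; set k := h`_0 in hc.
  have k0 : k != 0 by apply: contraNneq h0 => k0; rewrite hc k0.
  exists [::] => x _; rewrite hc hornerC; split => //.
  have TE y : 0 <= y -> T (E y%:P).
    by move=> y0; rewrite -[y]sqr_sqrtr // polyC_exp rmorphXn; apply: total_sqr.
  split => [/ltW/TE //|Tk]; rewrite lt_def k0 /= leNgt; apply/negP => kn.
  have TNk : T (- E k%:P).
    by rewrite -rmorphN -polyCN; apply: TE; rewrite oppr_ge0 ltW.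
  by case/eqP: h0; apply: E_inj; rewrite hc; apply: (preordering_anti pT).
have /closed_rootP [[a b] rz] : size (map_poly (real_complex R) h) != 1%N.
  by rewrite size_map_poly; case: (size h) sh => [|[]].
have step m : m %| h -> (1 < size m)%N -> same_sign_near m -> same_sign_near h.
  move=> dvd sm gm; have e : h = h %/ m * m by rewrite divpK.
  have m0 : m != 0 by rewrite -size_poly_gt0 ltnW.
  have q0 : h %/ m != 0 by apply: contraNneq h0 => q0; rewrite e q0 mul0r.
  rewrite e; apply: same_sign_mul => //; apply: IHn => //.
  by rewrite size_divp //; move: hn sh sm; set u := size h; set v := size m; lia.
have [b0|b0] := eqVneq b 0.
  apply: (step ('X - a%:P)); rewrite ?size_XsubC //.
    by rewrite dvdp_XsubCl -(fmorph_root (real_complex R)); move: rz; rewrite b0.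
  exists [:: a] => x /(_ a); rewrite inE eqxx => /(_ isT) [xa <-].
  by rewrite hornerXsubC subr_eq0 subr_gt0.
pose m := ('X - a%:P) ^+ 2 + (b ^+ 2)%:P.
have sm : size m = 3.
  by rewrite /m size_polyDl size_exp_XsubC // size_polyC; case: (_ != 0).
apply: (step m); rewrite ?sm //; last first.
  exists [::] => x _; have mx : 0 < m.[x].
    rewrite /m !hornerE ?horner_exp; apply: ltr_wpDl; first exact: sqr_ge0.
    by rewrite lt_def sqr_ge0 sqrf_eq0 b0.
  split; first by rewrite gt_eqF.
  split => // _; rewrite /m rmorphD polyC_exp !rmorphXn.
  by apply: (preorderingD pT); apply: total_sqr.
have m0 : m != 0 by rewrite -size_poly_gt0 sm.
have sr : (size (h %% m)%R <= 2)%N by have := ltn_modp h m; rewrite m0 sm.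
have rmz : root (map_poly (real_complex R) m) (Complex a b).
  rewrite /root /m rmorphD rmorphXn rmorphB /= map_polyX !map_polyC /= !hornerE ?horner_exp.
  by rewrite ?hornerE expr2; simpc; rewrite eq_complex /=; apply/andP; split; apply/eqP; ring.
(* The remainder has size at most 2 and vanishes at a + i b with b != 0, so both of its coefficients
   are 0. *)
have : root (map_poly (real_complex R) (h %% m)) (Complex a b).
  have -> : h %% m = h - h %/ m * m by rewrite {2}(divp_eq h m) addrC addKr.
  by rewrite rmorphB rmorphM /= /root hornerD hornerN hornerM (rootP rz) (rootP rmz) mulr0 subr0.
rewrite /root (@horner_coef_wide _ 2) ?size_map_poly // !big_ord_recl big_ord0 !coef_map /=.
rewrite expr0 mulr1 addr0 expr1; simpc; rewrite eq_complex /= => /andP[/eqP re /eqP im].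
have r1 : (h %% m)`_1 = 0.
  by move/eqP: im; rewrite mulf_eq0 (negPf b0) orbF => /eqP.
have r0 : (h %% m)`_0 = 0 by move: re; rewrite r1 mul0r addr0.
rewrite /dvdp -size_poly_eq0 -leqn0; apply/leq_sizeP => -[|[|i]] _ //.
by rewrite nth_default // (leq_trans sr).
Qed.

Theorem ordered_function_field_point (s : seq {poly R}) (g : {poly R}) : g != 0 ->
  (forall h, h \in s -> h != 0 /\ T (E h)) ->
  exists x, g.[x] != 0 /\ forall h, h \in s -> 0 < h.[x].
Proof.
move=> g0 sP; have [S0 S0P] := same_sign_poly g0.
have /choice [S SP] (h : {poly R}) : exists S, h \in s -> forall x, in_cut S x -> 0 < h.[x].
  have [hs|_] := boolP (h \in s); last by exists [::].
  have [h0 Th] := sP _ hs; have [S SP] := same_sign_poly h0.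
  by exists S => _ x /SP [_ ->].
have cut r r' : T (E ('X - r%:P)) -> ~ T (E ('X - r'%:P)) -> r < r'.
  move=> Tr nTr'; rewrite ltNge; apply/negP => r'r; apply: nTr'.
  have -> : 'X - r'%:P = ('X - r%:P) + (Num.sqrt (r - r'))%:P ^+ 2.
    by rewrite -polyC_exp sqr_sqrtr ?subr_ge0 // polyCB; ring.
  by rewrite rmorphD rmorphXn; apply: (preorderingD pT) => //; apply: total_sqr.
have [x xP] := @point_in_cut _ _ (S0 ++ flatten (map S s)) cut.
have inS S' : {subset S' <= S0 ++ flatten (map S s)} -> in_cut S' x.
  by move=> sub r /sub; apply: xP.
exists x; split.
  by have [] := S0P x (inS _ _) => // r rS; rewrite mem_cat rS.
move=> h hs; apply: (SP h hs); apply: inS => r rS; rewrite mem_cat; apply/orP; right.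
by apply/flattenP; exists (S h) => //; apply: map_f.
Qed.

End OrderedFunctionField.

Section BivariateEvaluation.
Variable R : rcfType.
Local Notation PP := {poly {poly R}}.

Definition eval2 (x y : R) : PP -> R := horner_eval y \o map_poly (horner_eval x).

Lemma eval2E x y c : eval2 x y c = (map_poly (horner_eval x) c).[y].
Proof. by []. Qed.

HB.instance Definition _ x y := GRing.RMorphism.on (eval2 x y).

Variables (U : set_system (R * R)) (UU : UltraFilter U).

(** Evaluation at a generic point of the plane: its coordinates are the classes of the two
    projections. *)
Definition ueval (c : PP) : ultrapower R UU := ucl UU (fun xy => eval2 xy.1 xy.2 c).

Lemma ueval_zmod : zmod_morphism ueval.
Proof.
move=> c d; rewrite /ueval [- ucl _ _]uoppE [ucl _ _ + _]uaddE.
by apply/ucl_eq/filterE => xy /=; rewrite rmorphB.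
Qed.

Lemma ueval_monoid : monoid_morphism ueval.
Proof.
split; first by apply/ucl_eq/filterE => xy /=; rewrite rmorph1.
move=> c d; rewrite /ueval [ucl _ _ * _]umulE.
by apply/ucl_eq/filterE => xy /=; rewrite rmorphM.
Qed.

HB.instance Definition _ := GRing.isZmodMorphism.Build PP (ultrapower R UU) ueval ueval_zmod.
HB.instance Definition _ := GRing.isMonoidMorphism.Build PP (ultrapower R UU) ueval ueval_monoid.

(** With X generic and Y any element of the ultrapower, the result is still a class of values of [c]
    at points of [R], so nonnegativity over [R] is inherited. *)
Lemma ueval_horner (c : PP) g :
  (map_poly (ueval \o polyC) c).[ucl UU g] = ucl UU (fun xy => eval2 xy.1 (g xy) c).
Proof.
rewrite (@horner_coef_wide _ (size c)) ?size_poly //.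
transitivity (\sum_(k < size c) ucl UU (fun xy => (c`_k).[xy.1] * g xy ^+ k)).
  apply: eq_bigr => k _; rewrite coef_map /= ucl_exp [LHS]umulE.
  apply/ucl_eq/filterE => xy /=.
  by rewrite eval2E map_polyC hornerC.
rewrite -ucl_sum; apply/ucl_eq/filterE => xy /=.
rewrite eval2E (@horner_coef_wide _ (size c)) ?size_poly //.
by apply: eq_bigr => k _; rewrite coef_map.
Qed.

End BivariateEvaluation.

Section MorphismFactor.
Variables (F M Omega : fieldType) (psi : {rmorphism F -> Omega}) (i : {rmorphism M -> Omega}).
Hypothesis psi_i : forall a, exists b, psi a = i b.

Definition morphism_factor a := projT1 (cid (psi_i a)).

Local Notation phi := morphism_factor.

Lemma morphism_factorE a : i (phi a) = psi a.
Proof. by rewrite /morphism_factor; case: cid. Qed.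

Lemma morphism_factor_zmod : zmod_morphism phi.
Proof. by move=> a b; apply: (fmorph_inj i); rewrite rmorphB !morphism_factorE rmorphB. Qed.

Lemma morphism_factor_monoid : monoid_morphism phi.
Proof.
split; first by apply: (fmorph_inj i); rewrite morphism_factorE !rmorph1.
by move=> a b; apply: (fmorph_inj i); rewrite rmorphM !morphism_factorE rmorphM.
Qed.

HB.instance Definition _ := GRing.isZmodMorphism.Build F M phi morphism_factor_zmod.
HB.instance Definition _ := GRing.isMonoidMorphism.Build F M phi morphism_factor_monoid.

End MorphismFactor.

(** * Artin's theorem in two variables *)

Section Artin.
Variable R : rcfType.
Local Notation PP := {poly {poly R}}.
Local Notation F := {fraction PP}.
Local Notation tofrac := (@FracField.tofrac PP).
Let E : {rmorphism {poly R} -> F} := tofrac \o polyC.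

Lemma E_inj h : E h = 0 -> h = 0.
Proof. by move=> /eqP; rewrite tofrac_eq0 polyC_eq0 => /eqP. Qed.

Section Ordered.
Variables (T : set F) (maxT : max_preordering T) (totT : forall a, T a \/ T (- a)).

(** Only signs of polynomials in X are prescribed, since points of [R] can realise these. The
    condition on [g] makes evaluation in the ultrapower injective, so that it extends to
    fractions. *)
Definition positivity_filter : set_system (R * R) := fun A =>
  exists (s : seq {poly R}) (g : PP), [/\ g != 0,
    forall h, h \in s -> h != 0 /\ T (E h) &
    forall x y, (forall h, h \in s -> 0 < h.[x]) -> eval2 x y g != 0 -> A (x, y)].

Lemma positivity_filter_proper : ProperFilter positivity_filter.
Proof.
apply: Build_ProperFilter_ex.
  move=> A [s [g [g0 sP AP]]].
  have l0 : lead_coef g != 0 by rewrite lead_coef_eq0.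
  have [x [gx sx]] := ordered_function_field_point E_inj maxT totT l0 sP.
  have gx0 : map_poly (horner_eval x) g != 0.
    by apply: contraNneq gx => e; rewrite -[_.[x]]/(horner_eval x _) lead_coefE -coef_map e coef0.
  (* The leading coefficient of [g] does not vanish at [x], so g(x, _) is nonzero and its Cauchy
     bound is not a root. *)
  pose y := cauchy_bound (map_poly (horner_eval x) g).
  exists (x, y); apply: AP => //; apply: (ge_cauchy_bound gx0).
  by rewrite in_itv /= lexx.
split.
- by exists [::], 1; split => //; rewrite oner_eq0.
- move=> A B [s [g [g0 sP AP]]] [s' [g' [g'0 s'P BP]]].
  exists (s ++ s'), (g * g'); split; first by rewrite mulf_neq0.
    by move=> h; rewrite mem_cat => /orP[/sP|/s'P].
  move=> x y hxy; rewrite rmorphM mulf_eq0 negb_or => /andP[gxy g'xy].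
  by split; [apply: AP|apply: BP] => // h hs; apply: hxy; rewrite mem_cat hs ?orbT.
- move=> A B AB [s [g [g0 sP AP]]]; exists s, g; split => // x y hxy gxy.
  by apply: AB; apply: AP.
Qed.

End Ordered.

Theorem hilbert17_bivariate (c : PP) :
  (forall x y, 0 <= eval2 x y c) -> is_sos (tofrac c).
Proof.
move=> c_ge0; apply: contrapT => nc.
have [T [maxT TNc totT]] := sos_or_ordered (fraction_char0 R) nc.
have [U [UU GU]] := ultraFilterLemma (positivity_filter_proper maxT totT).
have ueval_inj g : ueval UU g = 0 -> g = 0.
  move=> /ucl_eq g0; apply: contrapT => /eqP gn0.
  have : positivity_filter T [set xy | eval2 xy.1 xy.2 g != 0]%classic.
    by exists [::], g; split.
  move=> /GU gn; have [xy [/= /eqP]] := filter_ex (filterI gn g0).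
  by move=> ne e; apply: ne.
pose rho : {rmorphism F -> ultrapower R UU} := frac_lift ueval_inj.
(* R'[i] serves as an algebraically closed field containing R(X, Y). R' is known to respect [T] only
   on R(X), so R'' is built anew, from the image [T0] of [T]. *)
pose psi : {rmorphism F -> (ultrapower R UU)[i]} := real_complex _ \o rho.
pose T0 : set (ultrapower R UU)[i] := fun w => exists a, T a /\ w = psi a.
have pT := proj1 maxT.
have spanT0 w : span_sub T0 w -> exists a, w = psi a.
  by move=> [_ [_ [[a [_ ->]] [b [_ ->]] ->]]]; exists (a - b); rewrite rmorphB.
have psi_span a : span_sub T0 (psi a).
  have [t [s [Tt Ts ->]]] := total_span maxT totT a.
  by exists (psi t), (psi s); split; [exists t|exists s|rewrite rmorphB].
have pT0 : preordering T0.
  split.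
  - by exists 0; rewrite rmorph0; split => //; exact: (preordering0 pT).
  - by exists 1; rewrite rmorph1; split => //; exact: (preordering1 pT).
  - move=> _ _ [a [Ta ->]] [b [Tb ->]]; exists (a + b); rewrite rmorphD; split => //.
    exact: (preorderingD pT).
  - move=> _ _ [a [Ta ->]] [b [Tb ->]]; exists (a * b); rewrite rmorphM; split => //.
    exact: (preorderingM pT).
  - move=> [a [Ta e]]; apply: (preorderingN1 pT).
    by have -> : -1 = a by apply: (fmorph_inj psi); rewrite rmorphN1.
  - move=> _ /spanT0 [a ->]; exists (a ^+ 2); rewrite rmorphXn; split => //.
    exact: (total_sqr maxT totT).
  - by move=> _ /spanT0 [a ->]; rewrite -fmorphV.
have [T2 maxT2 T02] := max_preordering_exists pT0.
have psi_T2 a : exists b : ordered_subfield maxT2, psi a = osub_val b.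
  apply: osub_valP; have [t [s [Tt Ts ->]]] := psi_span a.
  by exists t, s; split => //; apply: T02.
pose phi : {rmorphism F -> ordered_subfield maxT2} := morphism_factor psi_T2.
have phi_ge0 a : T a -> 0 <= phi a.
  move=> Ta; apply/osub_ge0; rewrite [osub_val _]morphism_factorE.
  by apply: T02; exists a.
pose kappa : {rmorphism {fraction {poly R}} -> F} := frac_lift E_inj.
have rho_gt0 (h : {poly R}) : h != 0 -> T (E h) -> 0 < rho (E h).
  move=> h0 Th; have -> : rho (E h) = ueval UU h%:P by exact: frac_lift_tofrac.
  have hne : ueval UU h%:P != 0.
    by apply: contraNneq h0 => /ueval_inj/eqP; rewrite polyC_eq0.
  rewrite lt_def hne /=; apply/ucl_le.
  have : positivity_filter T [set xy | 0 < eval2 xy.1 xy.2 h%:P]%classic.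
    exists [:: h], 1; split; rewrite ?oner_eq0 //.
      by move=> g; rewrite inE => /eqP ->.
    move=> x y /(_ h); rewrite inE eqxx => /(_ isT) hx _ /=.
    by rewrite eval2E map_polyC hornerC.
  by move=> /GU; apply: filterS => xy /= /ltW.
(* On R(X) both embeddings respect [T]; for fractions, n / d has the sign of n d. *)
have gt0 (a : {fraction {poly R}}) : a != 0 -> T (kappa a) ->
    0 < rho (kappa a) /\ 0 < phi (kappa a).
  move=> a0 Ta; have ka0 : kappa a != 0 by rewrite fmorph_eq0.
  split; last by rewrite lt_def fmorph_eq0 ka0 phi_ge0.
  have [n [d [d0 e]]] := fraction_quotient a.
  have n0 : n != 0 by apply: contraNneq a0 => n0; rewrite e n0 tofrac0 mul0r.
  have Ed0 : E d != 0 by rewrite tofrac_eq0 polyC_eq0.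
  have ke : kappa a = E n / E d by rewrite e; apply: frac_liftE.
  have nd0 : n * d != 0 by rewrite mulf_neq0.
  have ke2 : E (n * d) = kappa a * E d ^+ 2.
    by rewrite rmorphM ke expr2 mulrA divfK.
  have Tnd : T (E (n * d)).
    by rewrite ke2; apply: (preorderingM pT) => //; exact: (total_sqr maxT totT).
  have := rho_gt0 _ nd0 Tnd; rewrite ke2 rmorphM pmulr_lgt0 // rmorphXn.
  by rewrite lt_def sqr_ge0 sqrf_eq0 fmorph_eq0 Ed0.
have same_sign (a : {fraction {poly R}}) :
    ((rho \o kappa) a < 0) = ((phi \o kappa) a < 0).
  have [->|a0] := eqVneq a 0; first by rewrite !rmorph0 !ltxx.
  have [Ta|TNa] := totT (kappa a) => /=.
    have [h1 h2] := gt0 a a0 Ta.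
    by rewrite [LHS]ltNge [RHS]ltNge (ltW h1) (ltW h2).
  have := gt0 (- a); rewrite oppr_eq0 rmorphN => /(_ a0 TNa) [].
  by rewrite !rmorphN !oppr_gt0 => -> ->.
pose f := map_poly (@FracField.tofrac {poly R}) c.
have kE h : kappa (FracField.tofrac h) = E h by exact: frac_lift_tofrac.
(* In R'' the image of Y is a point where [f] takes the negative value [phi (tofrac c)]; in R' all
   values of [f] are nonnegative. *)
have [|z] := negative_value_transfer same_sign (f := f).
  exists (phi (tofrac 'X)).
  have -> : (map_poly (phi \o kappa) f).[phi (tofrac 'X)] = phi (tofrac c).
    rewrite /f -map_poly_comp.
    pose g1 : {rmorphism PP -> ordered_subfield maxT2} := horner_eval (phi (tofrac 'X)) \o
      map_poly ((phi \o kappa) \o @FracField.tofrac {poly R}).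
    have : g1 =1 phi \o tofrac; last by apply.
    apply: poly_rmorphism_ext => [h|] /=.
      by rewrite /horner_eval map_polyC hornerC /= kE.
    by rewrite /horner_eval map_polyX hornerX.
  have := phi_ge0 _ TNc; rewrite rmorphN oppr_ge0 => le.
  rewrite lt_neqAle le andbT; apply/eqP => e; apply: nc.
  have -> : tofrac c = 0 by apply: (fmorph_inj phi); rewrite e rmorph0.
  exact: sos0.
apply/negP; rewrite -leNgt -[z]urepK /f -map_poly_comp.
have -> : map_poly ((rho \o kappa) \o @FracField.tofrac {poly R}) c =
    map_poly (ueval UU \o polyC) c.
  by apply: eq_map_poly => h /=; rewrite kE; exact: frac_lift_tofrac.
by rewrite ueval_horner; apply/ucl_le/filterE => xy; exact: c_ge0.
Qed.

End Artin.

(** * Representation by Pfister forms over R, R(X) and R(X, Y) *)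

Lemma pfister_common_denominator (K : fieldType) (p q xn xd yn yd zn zd wn wd : K) :
  xd != 0 -> yd != 0 -> zd != 0 -> wd != 0 ->
  pfister p q (xn / xd) (yn / yd) (zn / zd) (wn / wd) * (xd * yd * zd * wd) ^+ 2 =
  (xn * yd * zd * wd) ^+ 2 + p * (yn * xd * zd * wd) ^+ 2 +
  q * (zn * xd * yd * wd) ^+ 2 + p * q * (wn * xd * yd * zd) ^+ 2.
Proof. by move=> *; rewrite /pfister; field; apply/and4P. Qed.

Lemma represents_fraction (A : idomainType) (p q c : A) :
  represents (FracField.tofrac p) (FracField.tofrac q) (FracField.tofrac c) ->
  exists t x y z w, t != 0 /\ c * t ^+ 2 = x ^+ 2 + p * y ^+ 2 + q * z ^+ 2 + p * q * w ^+ 2.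
Proof.
move=> [x [y [z [w e]]]].
have [xn [xd [xd0 xE]]] := fraction_quotient x.
have [yn [yd [yd0 yE]]] := fraction_quotient y.
have [zn [zd [zd0 zE]]] := fraction_quotient z.
have [wn [wd [wd0 wE]]] := fraction_quotient w.
exists (xd * yd * zd * wd), (xn * yd * zd * wd), (yn * xd * zd * wd).
exists (zn * xd * yd * wd), (wn * xd * yd * zd); split; first by rewrite !mulf_neq0.
apply/eqP; rewrite -tofrac_eq; apply/eqP.
rewrite !(tofracD, tofracM, tofracXn) e /pfister xE yE zE wE.
by apply: pfister_common_denominator; rewrite tofrac_eq0.
Qed.

(** With denominators cleared, a representation is an identity in [B], and a retraction onto [A]
    that does not kill the common denominator [t] specialises it. *)
Lemma represents_descend (A B : idomainType) (iota : {rmorphism A -> B}) (p q c : A) :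
  (forall t : B, t != 0 ->
    exists pi : {rmorphism B -> A}, (forall a, pi (iota a) = a) /\ pi t != 0) ->
  represents (FracField.tofrac (iota p)) (FracField.tofrac (iota q)) (FracField.tofrac (iota c)) ->
  represents (FracField.tofrac p) (FracField.tofrac q) (FracField.tofrac c).
Proof.
move=> retract /represents_fraction [t [x [y [z [w [t0 e]]]]]].
have [pi [piK pit]] := retract t t0.
apply: (@represents_sqr_mulr _ _ _ (FracField.tofrac (pi t))); first by rewrite tofrac_eq0.
exists (FracField.tofrac (pi x)), (FracField.tofrac (pi y)).
exists (FracField.tofrac (pi z)), (FracField.tofrac (pi w)).
have := congr1 pi e; rewrite !(rmorphD, rmorphM, rmorphXn) !piK => /(congr1 (@FracField.tofrac A)).
by rewrite !(rmorphD, rmorphM, rmorphXn).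
Qed.

Lemma nonroot_natr (A : idomainType) (p : {poly A}) :
  (forall n, n.+1%:R != 0 :> A) -> p != 0 -> exists n, p.[n%:R] != 0.
Proof.
move=> char0 p0; apply: contrapT => /forallNP allr.
have inj : injective (fun n => n%:R : A).
  move=> n m; wlog nm : n m / (n <= m)%N => [wl|] e.
    by have [/wl|/ltnW/wl w] := leqP n m; [apply|apply/esym/w].
  apply/eqP; rewrite eqn_leq nm leqNgt -subn_gt0; apply/negP => mn.
  have := char0 (m - n).-1; rewrite prednK // natrB // e subrr eqxx.
  by [].
have := @max_poly_roots _ p [seq n%:R | n <- iota 0 (size p)] p0.
rewrite map_inj_uniq // iota_uniq size_map size_iota ltnn => h.
suff : false by []; apply: h => //; apply/allP => _ /mapP [n _ ->].
by apply/eqP; apply: contrapT => /eqP /allr.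
Qed.

Section Representation.
Variable R : rcfType.
Local Notation PP := {poly {poly R}}.

Lemma nonneg_represented (p q c : PP) : p != 0 -> q != 0 ->
  (forall x y, 0 <= eval2 x y c) ->
  represents (FracField.tofrac p) (FracField.tofrac q) (FracField.tofrac c).
Proof.
move=> p0 q0 /hilbert17_bivariate [s ->].
by apply: sum_squares_represented; rewrite tofrac_eq0.
Qed.

Lemma nonneg_represented_mpoly1 (p q c : {mpoly R[1]}) : p != 0 -> q != 0 ->
  (forall x, 0 <= c.@[x]) ->
  represents (FracField.tofrac p) (FracField.tofrac q) (FracField.tofrac c).
Proof.
move=> p0 q0 c0.
pose to : {rmorphism {mpoly R[1]} -> {poly R}} := mmap (@polyC R) (fun=> 'X).
have cm : commr_rmorph (@mpolyC 1 R) ('X_ord0 : {mpoly R[1]}) by move=> x; apply: mulrC.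
pose from : {rmorphism {poly R} -> {mpoly R[1]}} := horner_morph cm.
have fromK a : from (to a) = a.
  have -> : a = idfun a by []; apply: (mpoly_rmorphism_ext (f := from \o to)) => [k|i] /=.
    by rewrite mmapC; exact: horner_morphC.
  by rewrite mmapX mmap1U (ord1 i); exact: horner_morphX.
have toK a : to (from a) = a.
  have -> : a = idfun a by []; apply: (poly_rmorphism_ext (f := to \o from)) => [k|] /=.
    by rewrite /from /= horner_morphC mmapC.
  by rewrite /from /= horner_morphX mmapX mmap1U.
have to0 a : a != 0 -> to a != 0.
  by apply: contraNneq => a0; rewrite -(fromK a) a0 rmorph0.
apply: (@represents_descend _ _ (@polyC {poly R} \o to)); last first.
  apply: nonneg_represented; rewrite ?polyC_eq0 ?to0 //.
  move=> x y; have -> : eval2 x y (to c)%:P = c.@[fun=> x] by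
    rewrite eval2E map_polyC hornerC /=; apply: (mpoly_rmorphism_ext
      (f := horner_eval x \o to) (g := meval (fun=> x))) => [k|i] /=;
    rewrite ?mmapC ?mmapX ?mmap1U /horner_eval ?hornerC ?hornerX ?mevalC ?mevalXU.
  exact: c0.
move=> t t0.
(* The retraction substitutes for Y an integer that is not a root of the denominator. *)
have [n tn] : exists n, t.[n%:R] != 0.
  by apply: nonroot_natr => // n; rewrite -polyC_natr polyC_eq0 pnatr_eq0.
exists (from \o horner_eval n%:R); split => /= [a|].
  by rewrite /horner_eval hornerC fromK.
apply: contraNneq tn => e.
by rewrite -[_.[_]]toK [from _]e rmorph0.
Qed.

Lemma nonneg_represented_mpoly2 (p q c : {mpoly R[2]}) : p != 0 -> q != 0 ->
  (forall x, 0 <= c.@[x]) ->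
  represents (FracField.tofrac p) (FracField.tofrac q) (FracField.tofrac c).
Proof.
move=> p0 q0 c0.
pose h (i : 'I_2) : PP := if i == ord0 then 'X%:P else 'X.
pose to : {rmorphism {mpoly R[2]} -> PP} := mmap (@polyC _ \o @polyC R) h.
have cm : commr_rmorph (@mpolyC 2 R) ('X_ord0 : {mpoly R[2]}) by move=> x; apply: mulrC.
pose from1 : {rmorphism {poly R} -> {mpoly R[2]}} := horner_morph cm.
have cm2 : commr_rmorph from1 ('X_ord_max : {mpoly R[2]}) by move=> x; apply: mulrC.
pose from : {rmorphism PP -> {mpoly R[2]}} := horner_morph cm2.
have fromK a : from (to a) = a.
  have -> : a = idfun a by []; apply: (mpoly_rmorphism_ext (f := from \o to)) => [k|i] /=.
    by rewrite mmapC; apply: etrans (horner_morphC cm2 _) _; exact: horner_morphC.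
  rewrite mmapX mmap1U /h; case: eqP => [->|i0].
    by apply: etrans (horner_morphC cm2 _) _; exact: horner_morphX.
  apply: etrans (horner_morphX cm2) _; congr 'X__; apply/val_inj.
  by case: i i0 => [[|[|//]] Hi] //= []; apply/val_inj.
have toK a : to (from a) = a.
  have -> : a = idfun a by []; apply: (poly_rmorphism_ext (f := to \o from)) => [k|] /=.
    apply: (poly_rmorphism_ext (f := (to \o from) \o polyC) (g := polyC)) => [j|] /=.
      by rewrite /from /= horner_morphC /from1 /= horner_morphC mmapC.
    by rewrite /from /= horner_morphC /from1 /= horner_morphX mmapX mmap1U.
  by rewrite /from /= horner_morphX mmapX mmap1U.
have to0 a : a != 0 -> to a != 0.
  by apply: contraNneq => a0; rewrite -(fromK a) a0 rmorph0.
apply: (@represents_descend _ _ to); last first.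
  apply: nonneg_represented; rewrite ?to0 // => x y.
  pose v (i : 'I_2) := if i == ord0 then x else y.
  have -> : eval2 x y (to c) = c.@[v]; last exact: c0.
  apply: (mpoly_rmorphism_ext (f := eval2 x y \o to) (g := meval v)) => [k|i] /=.
    by rewrite mmapC eval2E /= map_polyC hornerC /= /horner_eval hornerC mevalC.
  rewrite mmapX mmap1U mevalXU eval2E /h /v; case: eqP => _.
    by rewrite map_polyC hornerC /= /horner_eval hornerX.
  by rewrite map_polyX hornerX.
move=> t t0; exists from; split => //.
by apply: contraNneq t0 => e; rewrite -(toK t) e rmorph0.
Qed.

End Representation.

(** * Positivity of rational functions *)

Lemma mpoly_nonroot (A : idomainType) (n : nat) (p : {mpoly A[n]}) :
  (forall k, k.+1%:R != 0 :> A) -> p != 0 -> exists v, p.@[v] != 0.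
Proof.
move=> char0; elim: n p => [|n IHn] p p0.
  exists (fun=> 0); apply: contraNneq p0 => e; apply/eqP.
  have pc : p = (p@_0)%:MP.
    apply/mpolyP => k; rewrite mcoeffC.
    have -> : k = 0%MM by apply/mnmP; case.
    by rewrite eqxx mulr1.
  by move: e; rewrite pc mevalC => ->; rewrite mpolyC0.
have ev_split (w : 'I_n.+1 -> A) q :
    q.@[w] = (mpoly_split q).[(w ord_max)%:MP].@[fun j => w (lift ord_max j)].
  apply: (mpoly_rmorphism_ext (f := meval w)
    (g := meval (fun j => w (lift ord_max j)) \o horner_eval (w ord_max)%:MP
            \o @mpoly_split A n)) => [c|i].
    by rewrite [RHS]/= mmapC /horner_eval hornerC /= !mevalC.
  rewrite [RHS]/= mmapX mmap1U /last_var /horner_eval /= mevalXU.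
  by case: unliftP => [j ->|->]; rewrite ?hornerC ?hornerX ?mevalXU ?mevalC.
have s0 : mpoly_split p != 0.
  by apply: contraNneq p0 => e; rewrite -(mpoly_splitK p) e rmorph0.
have [k|k] := @nonroot_natr _ (mpoly_split p) _ s0.
  by rewrite -mpolyC_nat mpolyC_eq0.
move=> /IHn [v nv]; exists (fun i => if unlift ord_max i is Some j then v j else k%:R).
rewrite ev_split unlift_none mpolyC_nat; apply: contraNneq nv => <-.
by apply/eqP; apply: meval_eq => j; rewrite liftK.
Qed.

(** On the line from [x] to a point where [q] does not vanish, [g] and [q] become polynomials in one
    variable. If g(x) < 0, then strictly between 0 and the next root of their product [g] is
    negative and [q] nonzero, a contradiction. *)
Lemma nonneg_cancel_square (R : rcfType) (n : nat) (g q : {mpoly R[n]}) : q != 0 ->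
  (forall x, 0 <= g.@[x] * q.@[x] ^+ 2) -> forall x, 0 <= g.@[x].
Proof.
move=> q0 gq x; rewrite leNgt; apply/negP => gx.
have [|v qv] := mpoly_nonroot _ q0; first by move=> k; rewrite pnatr_eq0.
pose line : {rmorphism {mpoly R[n]} -> {poly R}} :=
  mmap (@polyC R) (fun i => (x i)%:P + (v i - x i) *: 'X).
have lineE t p : (line p).[t] = p.@[fun i => x i + (v i - x i) * t].
  apply: (mpoly_rmorphism_ext (f := horner_eval t \o line)
    (g := meval (fun i => x i + (v i - x i) * t))) => [c|i].
    by rewrite /= mmapC /horner_eval hornerC mevalC.
  by rewrite /= mmapX mmap1U /horner_eval mevalXU hornerD hornerC hornerZ hornerX.
have line0 p : (line p).[0] = p.@[x].
  by rewrite lineE; apply: meval_eq => i; rewrite mulr0 addr0.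
have lq : line q != 0.
  apply: contraNneq qv => e; have : (line q).[1] = 0 by rewrite e horner0.
  by rewrite lineE => <-; apply/eqP; apply: meval_eq => i; rewrite mulr1 subrKC.
have lg0 : (line g).[0] < 0 by rewrite line0.
have lg : line g != 0 by apply: contraTneq lg0 => ->; rewrite horner0 ltxx.
pose P := line g * line q; have P0 : P != 0 by rewrite mulf_neq0.
pose c := next_root P 0 1; have c0 : 0 < c by apply: next_root_gt; rewrite ?ltr01.
have nr t : t \in `]0, c[ -> ~~ root P t by exact: next_noroot.
pose t := c / 2; have t0 : 0 < t by rewrite divr_gt0 // ltr0n.
have tc : t < c by rewrite ltr_pdivrMr ?ltr0n // ltr_pMr // ltr1n.
have := nr t; rewrite in_itv /= t0 tc => /(_ isT); rewrite rootM negb_or => /andP[gt qt].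
have lgt : (line g).[t] < 0.
  rewrite ltNge; apply/negP => gt0.
  have [|u /andP[u0 ut] ru] := @poly_ivt _ (line g) 0 t (ltW t0); first by rewrite (ltW lg0).
  have un0 : u != 0.
    by apply: contraTneq lg0 => e; rewrite e in ru; rewrite (rootP ru) ltxx.
  have := nr u; rewrite in_itv /= lt_neqAle eq_sym un0 u0 (le_lt_trans ut tc) => /(_ isT).
  by rewrite rootM ru.
have := gq (fun i => x i + (v i - x i) * t); rewrite -!lineE leNgt.
by rewrite nmulr_rlt0 // exprn_even_gt0 //= (rootPf qt).
Qed.

Section Positive.
Variables (R : rcfType) (m : nat).
Local Notation tofrac := (@FracField.tofrac {mpoly R[m.+1]}).

(** Reduces all representations of a fraction to one: p q' = p' q implies p' q' q^2 = p q q'^2, and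
    q^2 can be cancelled even at its zeros. *)
Lemma positive_quotient (p q : {mpoly R[m.+1]}) : q != 0 ->
  positive (tofrac p / tofrac q : ratfun R m.+1) <-> forall x, 0 <= (p * q).@[x].
Proof.
move=> q0; split => [pos x|pq x v [p' [q' [e q'x ->]]]].
  rewrite mevalM; have [->|qx] := eqVneq q.@[x] 0; first by rewrite mulr0.
  have := pos x (p.@[x] / q.@[x]).
  have h : ratfun_value (tofrac p / tofrac q) x (p.@[x] / q.@[x]) by exists p, q.
  move=> /(_ h) v0.
  have -> : p.@[x] * q.@[x] = p.@[x] / q.@[x] * q.@[x] ^+ 2 by field.
  by rewrite mulr_ge0 // sqr_ge0.
have q'0 : q' != 0 by apply: contraNneq q'x => ->; rewrite meval0.
have e' : p * q' = p' * q.
  apply/eqP; rewrite -tofrac_eq !tofracM -eqr_div ?tofrac_eq0 //.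
  by apply/eqP.
have h : 0 <= (p' * q').@[x].
  apply: (nonneg_cancel_square q0) => y.
  have -> : (p' * q').@[y] * q.@[y] ^+ 2 = (p * q).@[y] * q'.@[y] ^+ 2.
    have := congr1 (meval y) e'; rewrite !mevalM => ey.
    by transitivity ((p'.@[y] * q.@[y]) * (q'.@[y] * q.@[y])); [ring|rewrite -ey; ring].
  by rewrite mulr_ge0 ?sqr_ge0.
rewrite mevalM in h.
have -> : p'.@[x] / q'.@[x] = p'.@[x] * q'.@[x] * (q'.@[x]^-1) ^+ 2 by field.
by rewrite mulr_ge0 // sqr_ge0.
Qed.

Lemma positive_add_frac (f g : ratfun R m.+1) :
  positive f -> positive g -> positive (f + g).
Proof.
have [p [q [q0 ->]]] := fraction_quotient f; have [p' [q' [q'0 ->]]] := fraction_quotient g.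
move=> /(positive_quotient _ q0) pq /(positive_quotient _ q'0) pq'.
rewrite addf_div ?tofrac_eq0 // -!tofracM -tofracD.
apply/(positive_quotient _ (mulf_neq0 q0 q'0)) => x.
have -> : (p * q' + p' * q) * (q * q') = p * q * q' ^+ 2 + p' * q' * q ^+ 2 by ring.
by rewrite mevalD ![(_ * _ ^+ 2).@[x]]mevalM !rmorphXn addr_ge0 // mulr_ge0 // sqr_ge0.
Qed.

Lemma positive_mul_frac (f g : ratfun R m.+1) :
  positive f -> positive g -> positive (f * g).
Proof.
have [p [q [q0 ->]]] := fraction_quotient f; have [p' [q' [q'0 ->]]] := fraction_quotient g.
move=> /(positive_quotient _ q0) pq /(positive_quotient _ q'0) pq'.
rewrite mulf_div -!tofracM.
apply/(positive_quotient _ (mulf_neq0 q0 q'0)) => x.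
by rewrite mulrACA mevalM mulr_ge0.
Qed.

Lemma positive_sqr_frac (f : ratfun R m.+1) : positive (f ^+ 2).
Proof.
have [p [q [q0 ->]]] := fraction_quotient f.
rewrite expr_div_n -!tofracXn.
apply/(positive_quotient _ (expf_neq0 2 q0)) => x.
by rewrite -exprMn rmorphXn sqr_ge0.
Qed.

End Positive.

Lemma positiveD (R : rcfType) (m : nat) (f g : ratfun R m) :
  positive f -> positive g -> positive (f + g).
Proof. case: m f g => [|m] f g; [exact: addr_ge0|exact: positive_add_frac]. Qed.

Lemma positiveM (R : rcfType) (m : nat) (f g : ratfun R m) :
  positive f -> positive g -> positive (f * g).
Proof. case: m f g => [|m] f g; [exact: mulr_ge0|exact: positive_mul_frac]. Qed.

Lemma positive_sqr (R : rcfType) (m : nat) (f : ratfun R m) : positive (f ^+ 2).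
Proof. case: m f => [|m] f; [exact: sqr_ge0|exact: positive_sqr_frac]. Qed.

Lemma represents_fraction_of (A : idomainType) (K : fieldType) (f : {rmorphism A -> K})
    (pn pd qn qd cn cd : A) :
  (forall a, (f a == 0) = (a == 0)) -> pd != 0 -> qd != 0 -> cd != 0 ->
  represents (f (pn * pd)) (f (qn * qd)) (f (cn * cd)) ->
  represents (f pn / f pd) (f qn / f qd) (f cn / f cd).
Proof.
move=> f_inj pd0 qd0 cd0.
have f0 a : a != 0 -> f a != 0 by rewrite f_inj.
have clear a b : b != 0 -> f (a * b) = f a / f b * f b ^+ 2.
  by move=> /f0 b0; rewrite rmorphM; field.
rewrite !clear // => h; apply: (represents_sqr_mulr (f0 _ cd0)).
exact: (represents_clear_denominators (f0 _ pd0) (f0 _ qd0)).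
Qed.

Theorem positive_represented (R : rcfType) (m : nat) (p q c : ratfun R m) :
  (m <= 2)%N -> p != 0 -> q != 0 -> positive c -> represents p q c.
Proof.
case: m p q c => [|m] p q c hm p0 q0 posc.
  by rewrite -[c]sqr_sqrtr //; apply: represents_sqr.
move: p0 q0 posc.
have [pn [pd [pd0 ->]]] := fraction_quotient p.
have [qn [qd [qd0 ->]]] := fraction_quotient q.
have [cn [cd [cd0 ->]]] := fraction_quotient c.
rewrite !mulf_eq0 !invr_eq0 !tofrac_eq0 !negb_or => /andP[pn0 _] /andP[qn0 _].
move=> /(positive_quotient _ cd0) c_ge0.
apply: (represents_fraction_of (f := @FracField.tofrac {mpoly R[m.+1]})) => //.
  exact: tofrac_eq0.
case: m hm pn pd qn qd cn cd pd0 qd0 cd0 pn0 qn0 c_ge0 {p q c} => [|[|//]] _ *.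
  by apply: nonneg_represented_mpoly1; rewrite ?mulf_neq0.
by apply: nonneg_represented_mpoly2; rewrite ?mulf_neq0.
Qed.

(** * Diagonal hermitian forms *)

Section QuadraticExtension.
Variables (F : fieldType) (K : splittingFieldType F) (delta : F).
Hypothesis sqrt_ext : is_sqrt_extension K delta.
Variables (sigma : gal_of {:K}).
Hypotheses (sigma_gal : sigma \in 'Gal({:K} / 1)%g) (sigma_neq1 : sigma != 1%g).

Lemma sigma_alg a : sigma a%:A = a%:A :> K.
Proof. by apply: (fixed_gal (sub1v _) sigma_gal); rewrite rpredZ ?mem1v. Qed.

Lemma sigmaD a b : sigma (a + b) = sigma a + sigma b :> K.
Proof. exact: rmorphD. Qed.

Lemma sigmaM a b : sigma (a * b) = sigma a * sigma b :> K.
Proof. exact: rmorphM. Qed.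

Lemma sqrt_ext_decomposition : exists2 s : K, s ^+ 2 = delta%:A &
  forall z : K, exists x y : F, z = x%:A + y%:A * s.
Proof.
have [s [s2 full]] := sqrt_ext; exists s => // z.
have : z \in <<1; s>>%VS by rewrite full memvf.
move=> /Fadjoin_polyP [p /polyOverP p1 ->]; rewrite horner_coef.
elim/big_rec: _ => [|i w _ [x [y ->]]].
  by exists 0, 0; rewrite !scale0r mul0r addr0.
have /vlineP [k ->] := p1 i.
have [u [v ->]] : exists u v : F, s ^+ i = u%:A + v%:A * s.
  elim: (val i) => [|j [u [v e]]].
    by exists 1, 0; rewrite expr0 scale1r scale0r mul0r addr0.
  exists (v * delta), u; rewrite exprSr e mulrDl -mulrA -expr2 s2 addrC.
  by rewrite -in_algE -!in_algE rmorphM.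
exists (k * u + x), (k * v + y).
by rewrite -!in_algE !rmorphD !rmorphM; ring.
Qed.

Lemma conjugation : exists2 s : K, s ^+ 2 = delta%:A &
  (forall z : K, exists x y : F, z = x%:A + y%:A * s) /\
  forall x y : F, sigma (x%:A + y%:A * s) = x%:A - y%:A * s.
Proof.
have [s s2 dec] := sqrt_ext_decomposition; exists s => //; split => // x y.
have : sigma s ^+ 2 == s ^+ 2.
  by rewrite s2; apply/eqP; rewrite -(sigma_alg delta) -s2 rmorphXn.
rewrite sigmaD sigmaM !sigma_alg eqf_sqr => /orP[/eqP es|/eqP ->]; last by rewrite mulrN.
case/eqP: sigma_neq1; apply/eqP/gal_eqP => z _.
have [u [v ->]] := dec z; rewrite gal_id sigmaD sigmaM !sigma_alg.
by rewrite es.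
Qed.

Section Norms.
Variable s : K.
Hypothesis s2 : s ^+ 2 = delta%:A.
Hypothesis dec : forall z : K, exists x y : F, z = x%:A + y%:A * s.
Hypothesis sigmaE : forall x y : F, sigma (x%:A + y%:A * s) = x%:A - y%:A * s.

Lemma sigmaK z : sigma (sigma z) = z.
Proof.
have [x [y ->]] := dec z.
by rewrite sigmaE -mulNr -scaleNr sigmaE scaleNr mulNr opprK.
Qed.

Lemma conj_norm_basis x y :
  conj_norm sigma (x%:A + y%:A * s) = (x ^+ 2 - delta * y ^+ 2)%:A.
Proof.
rewrite /conj_norm sigmaE -subr_sqr exprMn s2.
by rewrite -!in_algE !expr2 rmorphB !rmorphM; ring.
Qed.

(** Invertibility of [Z] is recovered at the end, from Z^* Z being invertible. *)
Definition hermitian_diag_iso (n : nat) (d d' : 'rV[F]_n) := exists Z : 'M[K]_n,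
  conj_trmx sigma Z *m map_mx (in_alg K) (diag_mx d') *m Z = map_mx (in_alg K) (diag_mx d).

Lemma conj_trmxM n (Z W : 'M[K]_n) :
  conj_trmx sigma (Z *m W) = conj_trmx sigma W *m conj_trmx sigma Z.
Proof. by rewrite /conj_trmx -trmx_mul; congr trmx; exact: map_mxM. Qed.

(* The column (z, w) has length 1 for the form <a, b>, and (- b w^*, a z^* ) spans
   its orthogonal complement, with length a b; the matrix below is the inverse. *)
Lemma hermitian_plane_iso (d e : 'rV[F]_2) (z w : K) :
  (d 0 0)%:A * conj_norm sigma z + (d 0 1)%:A * conj_norm sigma w = 1 ->
  e 0 0 = 1 -> e 0 1 = d 0 0 * d 0 1 -> hermitian_diag_iso d e.
Proof.
rewrite /conj_norm => norm1 e0 e1.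
pose a : K := (d 0 0)%:A; pose b : K := (d 0 1)%:A.
exists (\matrix_(i < 2, j < 2)
  if i == 0 then (if j == 0 then a * sigma z else b * sigma w)
  else (if j == 0 then - w else z)).
have ord2 (i : 'I_2) : i = 0 \/ i = 1.
  by case: i => [[|[|//]] Hi]; [left|right]; apply/val_inj.
have sa : sigma a = a by exact: sigma_alg.
have sb : sigma b = b by exact: sigma_alg.
have sN x : sigma (- x) = - sigma x by exact: rmorphN.
have sum2 (f : 'I_2 -> K) : \sum_(i < 2) f i = f 0 + f 1.
  by rewrite !big_ord_recl big_ord0 addr0; congr (f _ + f _); apply/val_inj.
apply/matrixP => i j; rewrite !mxE sum2 !mxE !sum2 !mxE.
have ab : (d 0 0 * d 0 1)%:A = a * b by rewrite -!in_algE rmorphM.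
have simp := (mulr0n, mulr1n, scale0r, scale1r, mulr0, mulr1, addr0, add0r, ab,
  sigmaM, sa, sb, sN, sigmaK).
case: (ord2 i) => ->; case: (ord2 j) => -> /=; rewrite ?e0 ?e1 !simp.
- by transitivity (a * (a * (sigma z * z) + b * (sigma w * w)));
    [ring|rewrite norm1 mulr1].
- by ring.
- by ring.
- by transitivity (b * (a * (sigma z * z) + b * (sigma w * w)));
    [ring|rewrite norm1 mulr1].
Qed.

Lemma diag_mx_split (A : pzRingType) (p q : nat) (d : 'rV[A]_(p + q)) :
  diag_mx d = block_mx (diag_mx (lsubmx d)) 0 0 (diag_mx (rsubmx d)).
Proof. by rewrite -[d in LHS]hsubmxK diag_mx_row. Qed.

Lemma hermitian_block_iso (p q : nat) (d e : 'rV[F]_(p + q)) :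
  hermitian_diag_iso (lsubmx d) (lsubmx e) -> hermitian_diag_iso (rsubmx d) (rsubmx e) ->
  hermitian_diag_iso d e.
Proof.
move=> [Z hZ] [W hW]; exists (block_mx Z 0 0 W).
have conj0 m n : map_mx sigma (0 : 'M[K]_(m, n)) = 0 by exact: map_mx0.
rewrite /conj_trmx in hZ hW *.
rewrite (diag_mx_split d) (diag_mx_split e) !map_block_mx !conj0 !map_mx0 tr_block_mx.
by rewrite !trmx0 !mulmx_block !(mulmx0, mul0mx, addr0, add0r) hZ hW.
Qed.

Lemma hermitian_iso_refl n (d : 'rV[F]_n) : hermitian_diag_iso d d.
Proof.
exists 1%:M; rewrite mulmx1.
suff -> : conj_trmx sigma (1%:M : 'M[K]_n) = 1%:M by rewrite mul1mx.
have e : map_mx sigma (1%:M : 'M[K]_n) = 1%:M by exact: map_mx1.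
by rewrite /conj_trmx e trmx1.
Qed.

Lemma hermitian_iso_trans n (d e f : 'rV[F]_n) :
  hermitian_diag_iso d e -> hermitian_diag_iso e f -> hermitian_diag_iso d f.
Proof.
move=> [Z hZ] [W hW]; exists (W *m Z).
by rewrite conj_trmxM -!mulmxA (mulmxA (conj_trmx sigma W)) (mulmxA (_ *m _)) hW mulmxA.
Qed.

(* If a pair of entries a, b can always be replaced with 1, a b, then any
   diagonal form can be reduced to <1, ..., 1, product of the entries>. *)
Lemma hermitian_norm_iso (P : F -> Prop) :
  (forall a b, P a -> P b -> P (a * b)) ->
  (forall a b, P a -> P b -> exists z w : K,
    a%:A * conj_norm sigma z + b%:A * conj_norm sigma w = 1) ->
  forall n (d : 'rV[F]_n), (forall i, P (d 0 i)) -> is_norm sigma (\prod_i d 0 i) ->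
  hermitian_diag_iso d (const_mx 1).
Proof.
move=> PM Pnorm; case=> [|n] d Pd normd.
  by exists 1%:M; apply/matrixP => -[].
elim: n d Pd normd => [|n IHn] d Pd [w].
  rewrite big_ord_recl big_ord0 mulr1 => hw; exists w%:M.
  apply/matrixP => i j; rewrite !ord1 !mxE !big_ord_recl !big_ord0 !mxE.
  rewrite !big_ord_recl !big_ord0 !mxE /= !mulr1n scale1r mulr1 !addr0.
  exact: hw.
(* From (a, b, rest) to [e] = (1, a b, rest). The length is split as 2 + n to change the pair, and
   as 1 + n.+1 to apply induction to [d'] = (a b, rest), which has the same product. *)
move=> hw; pose d2 : 'rV[F]_(2 + n) := d.
pose d' : 'rV[F]_(1 + n) := row_mx (d 0 0 * d 0 1)%:M (rsubmx d2).
pose e1 : 'rV[F]_(1 + n.+1) := row_mx 1%:M d'; pose e : 'rV[F]_(2 + n) := e1.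
have d2E i : d2 0 i = d 0 i by [].
have dr i : rsubmx d2 0 i = d 0 (lift 0 (lift 0 i)).
  by rewrite mxE; congr (d 0 _); apply/val_inj.
have d'0 : d' 0 0 = d 0 0 * d 0 1.
  have -> : 0 = lshift n 0 :> 'I_(1 + n) by apply/val_inj.
  by rewrite row_mxEl mxE eqxx mulr1n.
have d'S i : d' 0 (lift 0 i) = d 0 (lift 0 (lift 0 i)).
  have ei : lift 0 i = rshift 1 i :> 'I_(1 + n) by apply/val_inj.
  by rewrite [in LHS]ei row_mxEr dr.
apply: (@hermitian_iso_trans _ _ (e : 'rV_n.+2)); last first.
  apply: (@hermitian_block_iso 1 n.+1).
    rewrite /e /e1 row_mxKl.
    have -> : lsubmx (const_mx 1 : 'rV[F]_(1 + n.+1)) = 1%:M.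
      by apply/matrixP => i j; rewrite !ord1 !mxE.
    exact: hermitian_iso_refl.
  rewrite /e /e1 row_mxKr.
  have -> : rsubmx (const_mx 1 : 'rV[F]_(1 + n.+1)) = const_mx 1.
    by apply/matrixP => i j; rewrite !mxE.
  apply: IHn.
    move=> i; case: (unliftP 0 i) => [j|] ->; first by rewrite d'S.
    by rewrite d'0; apply: PM.
  exists w; rewrite hw; congr (_%:A);
  rewrite big_ord_recl [X in _ * X]big_ord_recl mulrA [RHS]big_ord_recl; congr (_ * _).
    by rewrite -[RHS]/(d' 0 0) d'0; congr (_ * d 0 _); apply/val_inj.
  by apply: eq_bigr => i _; rewrite d'S.
have lE (u : 'rV[F]_(2 + n)) (i : 'I_2) : lsubmx u 0 i = u 0 (lshift n i) by rewrite mxE.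
have l0 : lshift n (0 : 'I_2) = 0 :> 'I_n.+2 by apply/val_inj.
have l1 : lshift n (1 : 'I_2) = 1 :> 'I_n.+2 by apply/val_inj.
apply: (@hermitian_block_iso 2 n).
  have [z [w' norm1]] := Pnorm _ _ (Pd 0) (Pd 1).
  apply: (@hermitian_plane_iso _ _ z w'); rewrite !lE ?l0 ?l1 //.
    have -> : 0 = lshift n.+1 (0 : 'I_1) :> 'I_n.+2 by apply/val_inj.
    by apply: etrans (row_mxEl (1%:M : 'rV[F]_1) d' 0 0) _; rewrite mxE eqxx.
  have -> : e 0 1 = e 0 (rshift 1 (0 : 'I_n.+1)) by congr (e 0 _); apply/val_inj.
  by apply: etrans (row_mxEr (1%:M : 'rV[F]_1) d' 0 0) _.
have -> : rsubmx e = rsubmx d2; last exact: hermitian_iso_refl.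
apply/rowP => i; rewrite mxE dr -d'S.
have -> : rshift 2 i = rshift 1 (lift 0 i) :> 'I_(1 + n.+1) by apply/val_inj.
exact: row_mxEr (1%:M : 'rV[F]_1) d' 0 _.
Qed.

End Norms.
End QuadraticExtension.

(** The representation of [a] is divided by [a]: the part x^2 - delta y^2 becomes [a] times a norm,
    the remaining part [b] times a norm. *)
Lemma unit_length_identity (F : fieldType) (a b delta x y z w : F) : a != 0 ->
  a = pfister (- delta) (a * b) x y z w ->
  a * ((x / a) ^+ 2 - delta * (y / a) ^+ 2) + b * (z ^+ 2 - delta * w ^+ 2) = 1.
Proof.
by move=> a0 e; apply: (mulfI a0); rewrite mulr1 [RHS]e /pfister; field.
Qed.

Lemma unit_length_vector (F : fieldType) (K : splittingFieldType F) (sigma : gal_of {:K})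
    (delta a b : F) (s : K) :
  s ^+ 2 = delta%:A -> (forall x y, sigma (x%:A + y%:A * s) = x%:A - y%:A * s) ->
  a != 0 -> represents (- delta) (a * b) a ->
  exists z w : K, a%:A * conj_norm sigma z + b%:A * conj_norm sigma w = 1.
Proof.
move=> s2 sigmaE a0 [x [y [z [w e]]]].
exists ((x / a)%:A + (y / a)%:A * s), (z%:A + w%:A * s).
rewrite !(conj_norm_basis s2 sigmaE) -!in_algE -!rmorphM -rmorphD.
by rewrite unit_length_identity // rmorph1.
Qed.

Theorem proposition5p5 (R : rcfType) (m : nat) (hm : (m <= 2)%N)
    (delta : ratfun R m) (K : splittingFieldType (ratfun R m))
    (hK : imaginary_extension K delta)
    (sigma : gal_of {:K}) (hsigma : sigma \in 'Gal({:K} / 1)%g)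
    (hsigma1 : sigma != 1%g)
    (n : nat) (hn : (0 < n)%N)
    (d : 'rV[ratfun R m]_n) (hD : diag_mx d \in unitmx) :
  (norm_closed sigma (fun i : 'I_n => d 0 i) /\
   (forall i : 'I_n, positive (d 0 i)))
  <->
  (exists Z : 'M[K]_n, Z \in unitmx /\
     conj_trmx sigma Z *m Z = map_mx (in_alg K) (diag_mx d)).
Proof.
have [delta0 pos_delta sqrt_ext] := hK.
have [s s2 [dec sigmaE]] := conjugation sqrt_ext hsigma hsigma1.
have d0 i : d 0 i != 0.
  by move: hD; rewrite unitmxE det_diag unitfE => /prodf_neq0; apply.
split=> [[normd posd]|[Z [_ hZ]]].
  have [|||Z] := @hermitian_norm_iso _ K sigma hsigma s dec sigmaE
    (fun a => a != 0 /\ positive a) _ _ n d _ normd.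
  - move=> a b [a0 posa] [b0 posb]; split; first by rewrite mulf_neq0.
    exact: positiveM.
  - move=> a b [a0 posa] [b0 _]; apply: (unit_length_vector s2 sigmaE a0).
    by apply: positive_represented; rewrite ?oppr_eq0 ?mulf_neq0.
  - by move=> i; split.
  rewrite diag_const_mx map_scalar_mx rmorph1 mulmx1 => hZ; exists Z; split => //.
  have : conj_trmx sigma Z *m Z \in unitmx by rewrite hZ map_unitmx.
  by rewrite unitmx_mul => /andP[].
split.
  (* The determinant of Z^* Z is the norm of the determinant of [Z]. *)
  exists (\det Z); rewrite /conj_norm.
  have -> : sigma (\det Z) = \det (conj_trmx sigma Z).
    by rewrite det_tr; apply: esym; exact: det_map_mx.
  by rewrite -det_mulmx hZ det_map_mx det_diag.
move=> i.
(* Each diagonal entry of Z^* Z is a sum of norms x^2 - delta y^2, which are positive because -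
   delta is. *)
have norm_sq (z : K) : exists x : ratfun R m, positive x /\ conj_norm sigma z = x%:A.
  have [x [y ->]] := dec z; exists (x ^+ 2 + - delta * y ^+ 2).
  split; last by rewrite (conj_norm_basis s2 sigmaE) mulNr.
  by apply: positiveD; [|apply: positiveM => //]; exact: positive_sqr.
have [x xE] := choice norm_sq.
have -> : d 0 i = \sum_j x (Z j i).
  apply: (fmorph_inj (in_alg K)); rewrite rmorph_sum.
  have := congr1 (fun A : 'M[K]_n => A i i) hZ; rewrite !mxE eqxx mulr1n => e.
  apply: etrans (esym e) _; apply: eq_bigr => j _.
  by rewrite !mxE; have [_] := xE (Z j i).
elim/big_rec: _ => [|j a _ posa].
  by rewrite -[0](expr0n _ 2); exact: positive_sqr.
by apply: positiveD posa; case: (xE (Z j i)).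
Qed.
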